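(* Let $(G,\mathfrak B)$ be a finitely generated, faithful, contracting, self-replicating self-similar branch group, with basis $\mathsf X$ and nucleus $\mathcal N$. Let $\nu_A$ be a cardinal-definite function on $G$. Then there exist $C>0$ and $n_0\ge1$ such that $$\nu_A(g)\le C\sum_{v\in\mathsf X^n}\ell_{\mathcal N}(g|_v)$$ for every $n\ge n_0$ and every $g\in\mathrm{RiSt}(n)'$. In particular, if $G$ is regular branch, then $G$ does not have Property PW.
   Context: Faithful self-similar groups. A self-similar group is a pair $(G,\mathfrak B)$ of a group $G$ and a set $\mathfrak B$ with commuting left and right $G$-actions, the right action being free with finitely many orbits; a basis is a subset $\mathsf X\subset\mathfrak B$ meeting every right orbit exactly once (so $\mathsf X$ is finite). Choosing a basis $\mathsf X$, a faithful self-similar group $(G,\mathfrak B)$ is the same as a subgroup $G\le\mathrm{Aut}(\mathsf X^* )$ of the automorphism group of the rooted tree of finite words over the finite alphabet $\mathsf X$, such that $g|_v\in G$ for all $g\in G$ and $v\in\mathsf X^*$, where the section $g|_v$ is defined by $g(vw)=g(v)g|_v(w)$ for all $w$. (The biset is then $\mathfrak B=\mathsf X\times G$ with $g_1\cdot(x\cdot h)\cdot g_2=g_1(x)\cdot(g_1|_xhg_2)$.) It is self-replicating if it acts transitively on $\mathsf X$ and, for $x\in\mathsf X$, the map $G_x\to G$, $g\mapsto g|_x$ from the stabilizer of $x$ is onto. It is contracting if there is a finite set $\mathcal N\subset G$ such that for every $g\in G$ there is $m$ with $g|_v\in\mathcal N$ whenever $|v|\ge m$; the smallest such $\mathcal N$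 is the nucleus. In the finitely generated self-replicating contracting case $\mathcal N$ generates $G$; $\ell_{\mathcal N}$ is the word length with respect to $\mathcal N$. Branch. $\mathrm{RiSt}(v)$ is the subgroup of elements of $G$ fixing every vertex outside $v\mathsf X^*$; $\mathrm{RiSt}(n)=\langle\mathrm{RiSt}(v):|v|=n\rangle$, and $\mathrm{RiSt}(n)'$ is its commutator subgroup. $G$ is branch if it is transitive on each $\mathsf X^n$ and each $\mathrm{RiSt}(n)$ has finite index in $G$. $G$ is regular branch if, for some basis $\mathsf X$ of $\mathfrak B$, there is a finite-index subgroup $K\le G$ with $K^{\mathsf X}\le K$, where $K^{\mathsf X}$ is the group of automorphisms of $\mathsf X^*$ fixing the first level pointwise with all first-level sections in $K$. Cardinal-definite functions. For a $G$-set $Y$ and a subset $A\subset Y$ with $gA\triangle A$ finite for all $g\in G$ (a commensurated subset), $\nu_A(g)=|gA\triangle A|$; functions of this form are cardinal-definite. $G$ has Property PW if some cardinal-definite function $\nu_A$ is proper, i.e. $\{g\in G:\nu_A(g)\le n\}$ is finite for every $n$.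
   Formalization: The final claim (a regular branch G does not have Property PW) is stated for a basis X with at least two elements; for |X| ≤ 1 faithfulness forces G to be trivial, and the trivial group has Property PW. *)

(* Defs.v *)
From mathcomp Require Import all_boot all_order all_algebra finmap.
From mathcomp Require Import boolp classical_sets cardinality reals.

Set Implicit Arguments.
Unset Strict Implicit.
Unset Printing Implicit Defensive.

Local Open Scope classical_set_scope.
Local Open Scope group_scope.

(* Subsets of a (possibly infinite) abstract group G are classical sets. *)

Definition is_subgroup (G : groupType) (H : set G) : Prop :=
  [/\ H 1, forall g h, H g -> H h -> H (g * h) & forall g, H g -> H g^-1].

Definition generated (G : groupType) (S : set G) : set G :=
  smallest (@is_subgroup G) S.

Definition finitely_generated (G : groupType) : Prop :=
  exists2 S : set G, finite_set S & generated S = [set: G].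

Definition commutator_subgroup (G : groupType) (H : set G) : set G :=
  generated [set c | exists g h, [/\ H g, H h & c = [~ g, h]]].

Definition finite_index (G : groupType) (H : set G) : Prop :=
  exists2 F : set G, finite_set F & forall g, exists2 f, F f & H (f^-1 * g).

Definition is_word_of_length (G : groupType) (S : set G) (g : G) (k : nat) :
    Prop :=
  exists s : seq G,
    [/\ size s = k, forall h, h \in s -> S h \/ S h^-1
      & g = \prod_(h <- s) h].

(* The junk value 0 is taken only outside the subgroup generated by S. *)
Definition word_length (G : groupType) (S : set G) (g : G) : nat :=
  if pselect (exists k, `[< is_word_of_length S g k >]) is left e
  then ex_minn e else 0.

Record biset (G : groupType) := Biset {
  bcar :> choiceType;
  lact : G -> bcar -> bcar;
  ract : bcar -> G -> bcar;
  lact1 : forall b, lact 1 b = b;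
  lactM : forall g h b, lact (g * h) b = lact g (lact h b);
  ract1 : forall b, ract b 1 = b;
  ractM : forall b g h, ract b (g * h) = ract (ract b g) h;
  lractA : forall g b h, ract (lact g b) h = lact g (ract b h);
  ract_free : forall b g, ract b g = b -> g = 1;
  ract_finite_orbits : exists F : {fset bcar},
    forall b, exists2 x, x \in F & exists g, b = ract x g }.

Arguments lact {G _}.
Arguments ract {G _}.

(* Since there are finitely many right orbits, a basis is automatically
   finite, so it is a finite subset X of the biset; X coerces to the finite
   type of its elements, which serves as the alphabet. *)
Record basis (G : groupType) (B : biset G) := Basis {
  bset :> {fset B};
  basisP : forall b : B, exists! x : bset, exists g, b = ract (val x) g }.

Section Tree.
Context {G : groupType} {B : biset G} (X : basis B).
Implicit Types (g h : G) (x y : X) (v w : seq X) (n : nat).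

Lemma decomp_subproof (b : B) : exists xh : X * G, b = ract (val xh.1) xh.2.
Proof. by have [x [[h bE] _]] := basisP X b; exists (x, h). Qed.

(* g . x = g(x) . g|_x with g(x) in X and g|_x in G *)
Definition decomp (b : B) : X * G := proj1_sig (cid (decomp_subproof b)).
Definition letter_act g x : X := (decomp (lact g (val x))).1.
Definition letter_section g x : G := (decomp (lact g (val x))).2.

Fixpoint word_act g w : seq X :=
  if w is x :: w' then letter_act g x :: word_act (letter_section g x) w'
  else [::].

Fixpoint section g v : G :=
  if v is x :: v' then section (letter_section g x) v' else g.

Lemma letter_actE g x :
  lact g (val x) = ract (val (letter_act g x)) (letter_section g x).
Proof. exact: proj2_sig (cid (decomp_subproof (lact g (val x)))). Qed.

Lemma word_act_cat g v w :
  word_act g (v ++ w) = word_act g v ++ word_act (section g v) w.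
Proof. by elim: v g => //= x v IHv g; rewrite IHv. Qed.

Definition faithful : Prop := forall g, (forall w, word_act g w = w) -> g = 1.

Definition self_replicating : Prop :=
  (forall x y, exists g, letter_act g x = y) /\
  (forall x h, exists2 g, letter_act g x = x & letter_section g x = h).

Definition contracting_set (N : set G) : Prop :=
  finite_set N /\
  forall g, exists m, forall v, (m <= size v)%N -> N (section g v).

Definition contracting : Prop := exists N, contracting_set N.

Definition is_nucleus (N : set G) : Prop :=
  contracting_set N /\ forall N', contracting_set N' -> N `<=` N'.

Definition rist v : set G :=
  [set g | forall w, ~~ prefix v w -> word_act g w = w].

Definition rist_level n : set G :=
  generated [set g | exists2 v : seq X, size v = n & rist v g].

Definition branch : Prop :=
  (forall v w, size v = size w -> exists g, word_act g v = w) /\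
  (forall n, finite_index (rist_level n)).

Definition tree_automorphism (a : seq X -> seq X) : Prop :=
  [/\ bijective a, forall w, size (a w) = size w
    & forall v w, prefix v w -> prefix (a v) (a w)].

(* K^X as a set of automorphisms of the tree X^*, for K a set of elements of
   the (faithfully acting) group G *)
Definition level1_power (K : set G) : set (seq X -> seq X) :=
  [set a | [/\ tree_automorphism a, forall x, a [:: x] = [:: x]
    & forall x, exists2 k, K k & forall w, a (x :: w) = x :: word_act k w]].

Definition regular_branch_over (K : set G) : Prop :=
  [/\ is_subgroup K, finite_index K
    & forall a, level1_power K a -> exists2 k, K k & word_act k =1 a].

End Tree.

Definition regular_branch (G : groupType) (B : biset G) : Prop :=
  exists (X : basis B) (K : set G), regular_branch_over X K.

Definition is_action (G : groupType) (Y : Type) (act : G -> Y -> Y) : Prop :=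
  (forall y, act 1 y = y) /\
  (forall g h y, act (g * h) y = act g (act h y)).

Definition commensurated (G : groupType) (Y : Type) (act : G -> Y -> Y)
    (A : set Y) : Prop :=
  forall g, finite_set ((act g @` A) `+` A).

Definition cardinal_definite (G : groupType) (nu : G -> nat) : Prop :=
  exists (Y : choiceType) (act : G -> Y -> Y) (A : set Y),
    [/\ is_action act, commensurated act A
      & forall g, nu g = #|` fset_set ((act g @` A) `+` A)|%fset].

Definition property_PW (G : groupType) : Prop :=
  exists2 nu : G -> nat, cardinal_definite nu
    & forall n, finite_set [set g | (nu g <= n)%N].

(* Main.v *)
Require Import Defs.
From mathcomp Require Import all_boot all_order all_algebra finmap.
From mathcomp Require Import boolp classical_sets cardinality reals.

(** Let [A] be a commensurated subset of a [G]-set.  Finite generation reduces to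
    a transitive [G]-set [Y] in which [A] is infinite and co-infinite.  For a
    vertex [v] the groups [L = RiSt(v)] and
    [Q = {g : g(v) = v, g|_v = 1}] commute and [L Q] has finite index, so both
    are finitely generated.  On every level some [v] has an infinite orbit [L y]
    ([v] is then active at [y]), and [A] cuts every such orbit into two
    infinite parts.

    If [Q y] is infinite as well, an element of [Q] displacing a finite
    connected set around the boundary of [A] makes [L y] two-ended; this yields
    a finite-index subgroup whose commutators fix [y], and since nontrivial
    normal subgroups of a branch group contain some [RiSt(m)'], the groups
    [RiSt(n)'], [n >= m], act trivially on [Y].

    Otherwise the active vertices of [y] form a ray, and the finite orbits [Q y]
    along it form a [G]-invariant equivalence relation.  Paths between classes
    can be lifted disjointly to all members of a class, so class sizes are
    bounded by the size of the boundary of [A] and [A] may be assumed to be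
    saturated.  By contraction, each [s] in the nucleus is the section at [v] of
    a word whose partial sections at [v] stay in a fixed finite set; hence the
    number of points near [v] where this word crosses the boundary of [A] is
    bounded independently of [v], which gives the linear bound.

    For a regular branch group, copying a nontrivial commutator [[a, b]] of a
    normal branching subgroup below deeper and deeper vertices gives infinitely
    many elements on which [nu] is bounded. *)

Set Implicit Arguments.
Unset Strict Implicit.
Unset Printing Implicit Defensive.

(** * Finite generation and finite index in abstract groups *)

Section AbstractGroups.
Local Open Scope classical_set_scope.
Local Open Scope group_scope.
Context {G : groupType}.
Implicit Types (g h : G) (S H K L : set G) (U V s w : seq G).

Lemma sub_generated S : S `<=` generated S.
Proof. by move=> g Sg H [_]; apply. Qed.

Lemma generated_subgroup S : is_subgroup (generated S).
Proof.
split=> [H [[]]//|g h Sg Sh H HS|g Sg H HS].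
- by have [[_ HM _] _] := HS; apply: HM; [apply: Sg|apply: Sh].
- by have [[_ _ HV] _] := HS; apply: HV; apply: Sg.
Qed.

Lemma generated_min S H : is_subgroup H -> S `<=` H -> generated S `<=` H.
Proof. by move=> Hg SH g; apply. Qed.

Lemma subgroup_prod H s :
  is_subgroup H -> (forall h, h \in s -> H h) -> H (\prod_(h <- s) h).
Proof.
move=> [H1 HM _]; elim: s => [|h s IH] sH; first by rewrite big_nil.
rewrite big_cons; apply: HM; first by apply: sH; rewrite inE eqxx.
by apply: IH => k ks; apply: sH; rewrite inE ks orbT.
Qed.

Lemma generated_word S g : generated S g ->
  exists2 s, forall h, h \in s -> S h \/ S h^-1 & g = \prod_(h <- s) h.
Proof.
pose P : set G := [set g | exists2 s,
  forall h, h \in s -> S h \/ S h^-1 & g = \prod_(h <- s) h].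
apply: (@generated_min S P) => [|h Sh]; last first.
  exists [:: h]; last by rewrite big_seq1.
  by move=> k; rewrite inE => /eqP ->; left.
split.
- by exists [::]; rewrite ?big_nil.
- move=> _ _ [s sS ->] [t tS ->]; exists (s ++ t); last by rewrite big_cat.
  by move=> h; rewrite mem_cat => /orP[/sS|/tS].
- move=> _ [s sS ->]; exists (rev [seq h^-1 | h <- s]).
    move=> h; rewrite mem_rev => /mapP[k /sS kS ->]; rewrite invgK.
    by case: kS; [right|left].
  elim: s {sS} => [|h s IH]; first by rewrite !big_nil invg1.
  by rewrite big_cons invgM IH /= rev_cons -cats1 big_cat big_seq1.
Qed.

(** Closing the list under inverses lets words be plain products of its entries, and makes every
    edge of a Schreier graph traversable both ways. *)
Definition fin_gen L U : Prop :=
  [/\ {in U, forall u, L u}, {in U, forall u, u^-1 \in U}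
    & forall l, L l -> exists2 s, {subset s <= U} & l = \prod_(h <- s) h].

(* For subgroups [H] of [K]: [H] has finite index in [K]. *)
Definition fin_sep K H : Prop := exists (T : finType) (c : G -> T),
  forall g h, K g -> K h -> c g = c h -> H (g^-1 * h).

Lemma finite_index_sep H : is_subgroup H -> finite_index H ->
  fin_sep [set: G] H.
Proof.
move=> [H1 HM HV] [F /finite_seqP[s ->] sH].
have sP g : exists i : 'I_(size s), H ((nth 1 s i)^-1 * g).
  have [f /= fs Hf] := sH g; rewrite -index_mem in fs.
  by exists (Ordinal fs); rewrite /= nth_index // -index_mem.
exists 'I_(size s), (fun g => projT1 (cid (sP g))) => g h _ _.
case: (cid (sP g)) => i ig; case: (cid (sP h)) => j jh /= ij; subst j.
by have := HM _ _ (HV _ ig) jh; rewrite invgM invgK -mulgA mulVKg.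
Qed.

Lemma fin_sep_reps K H : fin_sep K H -> exists2 F : seq G,
  {in F, forall f, K f} & forall g, K g -> exists2 f, f \in F & H (f^-1 * g).
Proof.
move=> [T [c cH]].
(* A colour not taken on [K] gets the junk representative 1; the filter below discards whatever is
   outside [K]. *)
pose r t : G := if pselect (exists2 g, K g & c g = t) is left e
  then s2val (cid2 e) else 1.
have rP g : K g -> K (r (c g)) /\ c (r (c g)) = c g.
  move=> Kg; rewrite /r; case: pselect => [e|]; last by case; exists g.
  by case: (cid2 e).
exists [seq f <- [seq r t | t : T] | `[< K f >]] => [f|g Kg].
  by rewrite mem_filter => /andP[/asboolP].
have [Kr cr] := rP g Kg; exists (r (c g)); last exact: cH.
rewrite mem_filter; apply/andP; split; first exact/asboolP.
by apply: map_f; rewrite mem_enum.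
Qed.

Lemma fin_sep_trans K H : is_subgroup K -> fin_sep [set: G] K ->
  fin_sep K H -> fin_sep [set: G] H.
Proof.
move=> [K1 KM KV] sK [T [c cH]]; have [F _ FK] := fin_sep_reps sK.
have rP g : exists i : 'I_(size F), K ((nth 1 F i)^-1 * g).
  have [f fF Kf] := FK g I; have iF := fF; rewrite -index_mem in iF.
  by exists (Ordinal iF); rewrite /= nth_index.
pose r g := projT1 (cid (rP g)).
exists ('I_(size F) * T)%type, (fun g => (r g, c ((nth 1 F (r g))^-1 * g))).
move=> g h _ _ [rgh]; rewrite -rgh => E.
have Kg : K ((nth 1 F (r g))^-1 * g) by rewrite /r; case: cid.
have Kh : K ((nth 1 F (r g))^-1 * h) by rewrite rgh /r; case: cid.
by have := cH _ _ Kg Kh E; rewrite invgM invgK -mulgA mulVKg.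
Qed.

(** Schreier's argument: a coset representative is pushed through a word from its right end, each
    letter [u] leaving behind some [f'^-1 * (u * f)] in [H]. *)
Lemma schreier U H : fin_gen [set: G] U -> is_subgroup H ->
  fin_sep [set: G] H -> exists V, fin_gen H V.
Proof.
move=> [_ UV UG] [H1 HM HV] /fin_sep_reps[F0 _ F0P].
(* The extra 1 here and in [1 :: U] makes the leftover representative a generator, in the form
   [1^-1 * (1 * f)]. *)
pose F := 1 :: F0.
pose V0 := [seq a.1^-1 * (u * a.2) | a <- [seq (f', f) | f' <- F, f <- F],
                                     u <- 1 :: U].
pose V := [seq v <- V0 | `[< H v >]].
have inV f f' u : f \in F -> f' \in F -> u \in 1 :: U ->
    H (f'^-1 * (u * f)) -> f'^-1 * (u * f) \in V.
  move=> fF f'F uU Hu; rewrite mem_filter; apply/andP; split;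
    first exact/asboolP.
  apply/flatten_mapP; exists (f', f); last by apply/mapP; exists u.
  by apply/flatten_mapP; exists f' => //; apply/mapP; exists f.
have key s : {subset s <= U} -> exists f w,
    [/\ f \in F, {subset w <= V} & \prod_(h <- s) h = f * \prod_(h <- w) h].
  elim: s => [|u s IH] sU.
    by exists 1, [::]; rewrite !big_nil mulg1 /F inE eqxx.
  have [|f [w [fF wV sE]]] := IH.
    by move=> h hs; apply: sU; rewrite inE hs orbT.
  have [f' f'F Hf] := F0P (u * f) I;
  have {}f'F : f' \in F by rewrite inE f'F orbT.
  exists f', (f'^-1 * (u * f) :: w); split=> //.
    move=> h; rewrite inE => /orP[/eqP->|/wV//].
    by apply: inV => //; rewrite inE sU ?orbT // inE eqxx.
  by rewrite !big_cons sE !mulgA mulgV mul1g.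
have F1 : 1 \in F by rewrite inE eqxx.
exists V; split.
- by move=> u; rewrite mem_filter => /andP[/asboolP].
- move=> v; rewrite mem_filter => /andP[/asboolP Hv].
  move=> /flatten_mapP[a /flatten_mapP[f' f'F /mapP[f fF ->]] /mapP[u uU vE]].
  have E : (f'^-1 * (u * f))^-1 = f^-1 * (u^-1 * f').
    by rewrite !invgM invgK mulgA.
  rewrite vE /= in Hv *; rewrite E; apply: inV => //; last by rewrite -E;
    apply: HV.
  by move: uU; rewrite !inE => /orP[/eqP->|/UV->]; rewrite ?invg1 ?eqxx ?orbT.
- move=> l Hl; have [s sU lE] := UG l I.
  have [f [w [fF wV sE]]] := key s sU.
  have Hw : H (\prod_(h <- w) h).
    apply: subgroup_prod => // h /wV; rewrite mem_filter.
    by move=> /andP[/asboolP].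
  have Hf : H f.
    have -> : f = l * (\prod_(h <- w) h)^-1 by rewrite lE sE mulgK.
    exact: HM (HV _ Hw).
  exists (f :: w); last by rewrite lE sE big_cons.
  move=> h; rewrite inE => /orP[/eqP->|/wV//].
  have -> : f = 1^-1 * (1 * f) by rewrite invg1 !mul1g.
  by apply: inV => //; rewrite ?inE ?eqxx // invg1 !mul1g.
Qed.

(* The projections of D = L Q onto its two factors are well defined because
   L and Q meet trivially. *)
Lemma fin_gen_factor D L Q V : is_subgroup L -> is_subgroup Q ->
  (forall l q, L l -> Q q -> l * q = q * l) ->
  (forall g, L g -> Q g -> g = 1) ->
  L `<=` D -> (forall d, D d -> exists2 l, L l & exists2 q, Q q & d = l * q) ->
  fin_gen D V -> exists U, fin_gen L U.
Proof.
move=> [L1 LM LV] [Q1 QM QV] LQ LQ1 LD DE [VD _ Vgen].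
pose p d : G := if pselect (exists2 l, L l & exists2 q, Q q & d = l * q)
  is left e then s2val (cid2 e) else 1.
have pL d : L (p d) by rewrite /p; case: pselect => // e; case: (cid2 e).
have pQ d : D d -> exists2 q, Q q & d = p d * q.
  move=> /DE dE; rewrite /p; case: pselect => // e.
  by case: (cid2 e).
have Lp s : L (\prod_(h <- [seq p v | v <- s]) h).
  by elim: s => [|v s IH] /=; rewrite ?big_nil // big_cons; apply: LM.
pose U0 := [seq p v | v <- V].
exists (U0 ++ [seq u^-1 | u <- U0]); split.
- move=> u; rewrite mem_cat => /orP[/mapP[v _ ->]//|].
  by move=> /(@mapP G G)[w /mapP[v _ ->] ->]; apply: LV.
- move=> u; rewrite !mem_cat => /orP[uU|/(@mapP G G)[w wU ->]].
    by rewrite map_f ?orbT.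
  by rewrite invgK wU.
- move=> l Ll; have [s sV lE] := Vgen _ (LD _ Ll).
  exists [seq p v | v <- s].
    by move=> u /mapP[v /sV vV ->]; rewrite mem_cat map_f.
  have [q Qq sE] : exists2 q, Q q &
      \prod_(v <- s) v = \prod_(h <- [seq p v | v <- s]) h * q.
    elim: s sV {lE} => [|v s IH] sV.
      by exists 1 => //=; rewrite !big_nil mulg1.
    have [|q Qq sE] := IH.
      by move=> x xs; apply: sV; rewrite inE xs orbT.
    have [|q' Qq' vE] := pQ v; first by apply: VD; apply: sV; rewrite inE eqxx.
    exists (q' * q); first exact: QM.
    rewrite /= !big_cons sE [in LHS]vE -!mulgA; congr (_ * _).
    rewrite !mulgA; congr (_ * _); rewrite -LQ //.
  set m := \prod_(h <- map p s) h in sE *.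
  have Lm : L m by apply: Lp.
  have qE : q = m^-1 * l by rewrite lE sE mulKg.
  have := LQ1 (m^-1 * l) (LM _ _ (LV _ Lm) Ll); rewrite -qE => /(_ Qq) q1.
  by rewrite lE sE q1 mulg1.
Qed.

(** The core is the kernel of the action on cosets, so [k] is determined modulo it by the cosets of
    the products [k * f], for [f] in a finite list of representatives. *)
Lemma finite_index_core H : is_subgroup H -> fin_sep [set: G] H ->
  fin_sep [set: G] [set k | forall g, H (g^-1 * k * g)].
Proof.
move=> [H1 HM HV] sH; have [F _ FP] := fin_sep_reps sH.
have [T [c cH]] := sH.
exists {ffun 'I_(size F) -> T}, (fun k => [ffun i : 'I_(size F) =>
  c (k * nth 1 F i)]).
move=> k k' _ _ /ffunP E g; have [f fF Hg] := FP g I.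
have iF := fF; rewrite -index_mem in iF.
have := E (Ordinal iF); rewrite !ffunE /= !nth_index // => /(cH _ _ I I) Hf.
have := HM _ _ (HM _ _ (HV _ Hg) Hf) Hg.
by rewrite !(invgM, invgK, mulgA) !mulgK.
Qed.

(** For fixed [a], the [b] with [[~ a, b]] in the normal subgroup [N] form a subgroup; two passes
    extend the condition from generators to all elements. *)
Lemma commg_congr_generated S N g h : is_subgroup N ->
  (forall g k, N k -> N (g^-1 * k * g)) ->
  (forall a b, S a -> S b -> N [~ a, b]) ->
  generated S g -> generated S h -> N [~ g, h].
Proof.
move=> [N1 NM NV] NJ SN.
have R a b : N [~ a, b] -> N [~ b, a] by move=> /NV; rewrite invgR.
have C a : is_subgroup [set b | N [~ a, b]].
  split=> [/=|b c /= Nb Nc|b /= Nb]; first by rewrite commg1.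
  - have -> : [~ a, b * c] = [~ a, c] * (c^-1 * [~ a, b] * c).
      by rewrite /commg /conjg !invgM !mulgA !mulgK.
    by apply: NM => //; apply: NJ.
  - have -> : [~ a, b^-1] = (b^-1)^-1 * [~ b, a] * b^-1.
      by rewrite /commg /conjg !invgK !mulgA mulgV mul1g.
    by apply: NJ; apply: R.
move=> Sg; move: h; apply: (generated_min (C g)).
move=> b Sb /=; apply: (R); move: g Sg; apply: (generated_min (C b)).
by move=> a Sa; apply: R; apply: SN.
Qed.

(** Pigeonhole: two distinct elements of [H] share a class, and their quotient is the required
    element. *)
Lemma fin_sep_infinite (H K : set G) : fin_sep [set: G] K -> ~ finite_set H ->
  is_subgroup H -> exists k, [/\ H k, K k & k != 1].
Proof.
move=> [T [c cK]] /(@infinite_set_fset _ _ #|T|.+1)[F FH cF] [_ HM HV].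
apply: contrapT => no.
have : (size [seq c g | g <- F] <= #|T|)%N.
  rewrite -(card_uniqP _) ?max_card // map_inj_in_uniq ?fset_uniq //.
  move=> g h gF hF /(cK g h I I) Kgh; apply: contrapT => gh; apply: no.
  exists (g^-1 * h); split=> //; first by apply: HM (HV _ (FH _ gF)) (FH _ hF).
  by apply/negP => /eqP/mulg1_eq; rewrite invgK.
by rewrite size_map leqNgt cF.
Qed.


End AbstractGroups.

(** * The action on the tree, rigid stabilizers and kernels at a vertex *)

Section TreeAction.
Local Open Scope classical_set_scope.
Local Open Scope group_scope.
Context {G : groupType} {B : biset G} (X : basis B).
Implicit Types (g h k : G) (x y : X) (u v w : seq X).

Lemma ract_basis_inj x y g h :
  ract (val x) g = ract (val y) h -> x = y /\ g = h.
Proof.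
move=> E; have [z [_ zU]] := basisP X (ract (val x) g).
have zx : z = x by apply: zU; exists g.
have xy : x = y by rewrite -zx; apply: zU; exists h.
split=> //; move: E; rewrite -xy => /(congr1 (fun b => ract b h^-1)).
rewrite -!ractM mulgV ract1 => /ract_free.
exact: divg1_eq.
Qed.

Lemma letter_actP g x y h : lact g (val x) = ract (val y) h ->
  letter_act g x = y /\ letter_section g x = h.
Proof. by rewrite letter_actE => /ract_basis_inj[]. Qed.

Lemma letter_act1 x : letter_act 1 x = x /\ letter_section 1 x = 1.
Proof. by apply: letter_actP; rewrite lact1 ract1. Qed.

Lemma letter_actM g h x :
  letter_act (g * h) x = letter_act g (letter_act h x) /\
  letter_section (g * h) x =
    letter_section g (letter_act h x) * letter_section h x.
Proof.
by apply: letter_actP; rewrite lactM letter_actE -lractA letter_actE ractM.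
Qed.

Lemma word_act1 w : word_act 1 w = w.
Proof. by elim: w => //= x w IH; have [-> ->] := letter_act1 x; rewrite IH. Qed.

Lemma section1 w : section 1 w = 1.
Proof. by elim: w => //= x w IH; have [_ ->] := letter_act1 x; rewrite IH. Qed.

Lemma word_actM g h w : word_act (g * h) w = word_act g (word_act h w).
Proof.
elim: w g h => //= x w IH g h.
by have [-> ->] := letter_actM g h x; rewrite IH.
Qed.

Lemma sectionM g h w :
  section (g * h) w = section g (word_act h w) * section h w.
Proof.
elim: w g h => //= x w IH g h.
by have [_ ->] := letter_actM g h x; rewrite IH.
Qed.

Lemma section_cat g v w : section g (v ++ w) = section (section g v) w.
Proof. by elim: v g => //= x v IH g; rewrite IH. Qed.

Lemma size_word_act g w : size (word_act g w) = size w.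
Proof. by elim: w g => //= x w IH g; rewrite IH. Qed.

Lemma word_actK g : cancel (@word_act _ _ X g) (word_act g^-1).
Proof. by move=> w; rewrite -word_actM mulVg word_act1. Qed.

Lemma word_actVK g : cancel (@word_act _ _ X g^-1) (word_act g).
Proof. by move=> w; rewrite -word_actM mulgV word_act1. Qed.

Lemma word_act_inj g : injective (@word_act _ _ X g).
Proof. exact: can_inj (@word_actK g). Qed.

Lemma sectionV g w :
  section g^-1 w = (section g (word_act g^-1 w))^-1.
Proof.
by apply/esym/mulg1_eq; rewrite -sectionM mulgV section1.
Qed.

Lemma prefix_word_act g v w :
  prefix (word_act g v) (word_act g w) = prefix v w.
Proof.
have H h v' w' : prefix v' w' -> prefix (word_act h v') (word_act h w').
  by move=> /prefixP[u ->]; rewrite word_act_cat prefix_prefix.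
apply/idP/idP; last exact: H.
by move=> /(H g^-1); rewrite !word_actK.
Qed.

Lemma prefix_size_eq u v w : size u = size v -> prefix v (u ++ w) -> u = v.
Proof.
by move=> s /prefixP[w' /eqP]; rewrite eqseq_cat // => /andP[/eqP].
Qed.

(** The group [Q] of the overview. Asking for section 1 makes it fix the subtree below [v] without
    appeal to faithfulness. *)
Definition point_kernel v : set G :=
  [set g | word_act g v = v /\ section g v = 1].

Lemma point_kernel_fix v g w :
  point_kernel v g -> word_act g (v ++ w) = v ++ w.
Proof. by move=> [gv gs]; rewrite word_act_cat gv gs word_act1. Qed.

Lemma point_kernel_prefix v g w :
  point_kernel v g -> prefix v (word_act g w) = prefix v w.
Proof. by move=> [gv _]; rewrite -{1}gv prefix_word_act. Qed.

Lemma rist_fix v g : rist v g -> word_act g v = v.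
Proof.
move=> Hg; case: (boolP (prefix v (word_act g v))) => [|/Hg].
  have := @prefix_size_eq (word_act g v) v [::]; rewrite cats0.
  by apply; rewrite size_word_act.
exact: word_act_inj.
Qed.

Lemma rist_subgroup v : is_subgroup (rist v).
Proof.
split=> [w _|g h Hg Hh w vw|g Hg w vw]; first exact: word_act1.
  by rewrite word_actM Hh // Hg.
by rewrite -{1}(Hg w) // word_actK.
Qed.

Lemma point_kernel_subgroup v : is_subgroup (point_kernel v).
Proof.
split=> [|g h [gv gs] [hv hs]|g [gv gs]].
- by split; rewrite ?word_act1 ?section1.
- by split; rewrite ?word_actM ?sectionM hv ?gv ?gs ?hs ?mulg1.
- have gv' : word_act g^-1 v = v by rewrite -{1}gv word_actK.
  by split=> //; rewrite sectionV gv' gs invg1.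
Qed.

Lemma rist_sub v w : prefix v w -> rist w `<=` rist v.
Proof.
move=> vw g Hg u vu; apply: Hg; apply: contraNN vu.
exact: prefix_trans.
Qed.

Lemma point_kernel_sub v w :
  prefix v w -> point_kernel v `<=` point_kernel w.
Proof.
move=> /prefixP[u ->] g gQ; split; first exact: point_kernel_fix.
by rewrite section_cat gQ.2 section1.
Qed.

Lemma ristJ v g l :
  rist v l -> rist (word_act g v) (g * l * g^-1).
Proof.
move=> Hl w vw; rewrite !word_actM Hl ?word_actVK //.
by rewrite -(prefix_word_act g) word_actVK.
Qed.

Lemma point_kernelJ v g q : point_kernel v q ->
  point_kernel (word_act g v) (g * q * g^-1).
Proof.
move=> [qv qs]; split; first by rewrite !word_actM word_actK qv.
rewrite !sectionM word_actK qv qs mulg1 sectionV word_actK.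
by rewrite mulgV.
Qed.

(** Lets an element be replaced, at [v], by any other with the same image and section, at the cost
    of a factor from [Q]. *)
Lemma same_section_point_kernel g h v : word_act g v = word_act h v ->
  section g v = section h v -> point_kernel v (g^-1 * h).
Proof.
move=> gh sgh; split; first by rewrite word_actM -gh word_actK.
by rewrite sectionM sectionV -gh word_actK sgh mulVg.
Qed.

Section Faithful.
Hypothesis fX : faithful X.

Lemma word_act_ext g h : @word_act _ _ X g =1 word_act h -> g = h.
Proof.
move=> gh; apply: divg1_eq; apply: fX => w.
by rewrite word_actM gh word_actVK.
Qed.

Lemma rist_section1 u v g :
  rist v g -> size u = size v -> u != v -> section g u = 1.
Proof.
move=> Hg su uv; apply: fX => w.
have E z : word_act g (u ++ z) = u ++ z.
  by apply: Hg; apply: contraNN uv => /(prefix_size_eq su) ->.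
have := E w; rewrite word_act_cat.
have := E [::]; rewrite !cats0 => -> /eqP.
by rewrite eqseq_cat // eqxx => /eqP.
Qed.

Lemma rist_point_kernel u v :
  size u = size v -> u != v -> rist v `<=` point_kernel u.
Proof.
move=> su uv g Hg; split; last exact: rist_section1 uv.
by apply: Hg; apply: contraNN uv => p;
  rewrite (@prefix_size_eq u v [::]) ?cats0.
Qed.

(** Disjoint supports: [l] moves only words below [v], and [q] only words that are not. *)
Lemma rist_point_kernelC v l q :
  rist v l -> point_kernel v q -> l * q = q * l.
Proof.
move=> Hl Hq; apply: word_act_ext => w; rewrite !word_actM.
have [/prefixP[u ->]|vw] := boolP (prefix v w).
  have lv := rist_fix Hl.
  by rewrite (point_kernel_fix _ Hq) word_act_cat lv (point_kernel_fix _ Hq).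
by rewrite (Hl w) // Hl // point_kernel_prefix.
Qed.

Lemma rist_point_kernelI v g : rist v g -> point_kernel v g -> g = 1.
Proof.
move=> Hl Hq; apply: fX => w.
by have [/prefixP[u ->]|/Hl//] := boolP (prefix v w); rewrite point_kernel_fix.
Qed.

Definition rist_prod v : set G :=
  [set g | exists2 l, rist v l & exists2 q, point_kernel v q & g = l * q].

Lemma rist_prod_subgroup v : is_subgroup (rist_prod v).
Proof.
have [L1 LM LV] := rist_subgroup v; have [Q1 QM QV] := point_kernel_subgroup v.
split.
- by exists 1 => //; exists 1; rewrite ?mulg1.
- move=> _ _ [l Ll [q Qq ->]] [l' Ll' [q' Qq' ->]].
  exists (l * l'); first exact: LM; exists (q * q'); first exact: QM.
  by rewrite !mulgA; congr (_ * _); rewrite -!mulgA (rist_point_kernelC Ll').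
- move=> _ [l Ll [q Qq ->]]; exists l^-1; first exact: LV.
  exists q^-1; first exact: QV.
  by rewrite invgM (rist_point_kernelC (LV _ Ll) (QV _ Qq)).
Qed.

(** Generators supported below [v] lie in [L], those below other vertices of the level in [Q]; so
    [L Q] inherits finite index from the branch condition. *)
Lemma rist_level_prod n v : size v = n -> rist_level X n `<=` rist_prod v.
Proof.
move=> sv; apply: generated_min; first exact: rist_prod_subgroup.
move=> g [w sw Hg]; have [vw|vw] := eqVneq v w.
  exists g; first by rewrite vw.
  by exists 1; rewrite ?mulg1; first by case: (point_kernel_subgroup v).
exists 1; first by case: (rist_subgroup v).
by exists g; rewrite ?mul1g //; apply: rist_point_kernel Hg; rewrite ?sv.
Qed.

End Faithful.

Lemma rist_level_fix n g v :
  rist_level X n g -> size v = n -> word_act g v = v.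
Proof.
move=> Hg sv; move: g Hg; apply: (@generated_min _ _
  [set g | word_act g v = v]).
  split=> [|g h /= gv hv|g /= gv]; first exact: word_act1.
    by rewrite word_actM hv.
  by rewrite -{1}gv word_actK.
move=> g [w sw Hg] /=; have [vw|vw] := eqVneq v w.
  by rewrite vw; apply: rist_fix.
apply: Hg; apply: contraNN vw => p.
by rewrite (@prefix_size_eq v w [::]) ?cats0 ?sv.
Qed.

Lemma commutator_sub (H : set G) :
  is_subgroup H -> commutator_subgroup H `<=` H.
Proof.
move=> HG; apply: generated_min => // _ [g [h [Hg Hh ->]]].
by case: HG => _ HM HV; exact: HM (HV _ Hg) (HM _ _ (HV _ Hh) (HM _ _ Hg Hh)).
Qed.

End TreeAction.

(** * Uniform choices over a finite list *)

Lemma uniform_bound (T : eqType) (s : seq T) (P : T -> nat -> Prop) :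
  {in s, forall x, exists m, forall n, (m <= n)%N -> P x n} ->
  exists m, {in s, forall x n, (m <= n)%N -> P x n}.
Proof.
elim: s => [|x s IH] H; first by exists 0.
have [m mP] := H x (mem_head _ _).
have [y ys|m' m'P] := IH; first by apply: H; rewrite inE ys orbT.
exists (maxn m m') => y; rewrite inE => /orP[/eqP->|ys] n; rewrite geq_max.
  by move=> /andP[/mP].
by move=> /andP[_]; apply: m'P.
Qed.

Lemma uniform_seq (T U : eqType) (s : seq T) (P : T -> seq U -> Prop) :
  (forall x M M', {subset M <= M'} -> P x M -> P x M') ->
  {in s, forall x, exists M, P x M} -> exists M, {in s, forall x, P x M}.
Proof.
move=> mono; elim: s => [|x s IH] H; first by exists [::].
have [M MP] := H x (mem_head _ _).
have [y ys|M' M'P] := IH; first by apply: H; rewrite inE ys orbT.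
exists (M ++ M') => y; rewrite inE => /orP[/eqP->|ys].
  by apply: mono MP => z zM; rewrite mem_cat zM.
by apply: mono (M'P _ ys) => z zM; rewrite mem_cat zM orbT.
Qed.

(** * Contraction, and lifting with bounded sections *)

Section Contraction.
Local Open Scope classical_set_scope.
Local Open Scope group_scope.
Context {G : groupType} {B : biset G} (X : basis B).
Implicit Types (g h : G) (x y : X) (v : seq X).

Fixpoint set_pow (W : set G) k : set G :=
  if k is k'.+1 then [set a * b | a in W & b in set_pow W k'] else [set 1].

Lemma finite_set_pow W k : finite_set W -> finite_set (set_pow W k).
Proof.
move=> fW; elim: k => [|k IH] /=; first exact: finite_set1.
exact: finite_image2.
Qed.

Lemma set_powD W j k a b :
  set_pow W j a -> set_pow W k b -> set_pow W (j + k) (a * b).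
Proof.
move=> + Wb; elim: j a => [_ ->|j IH _ [c Wc [d /IH Wd] <-]] /=.
  by rewrite mul1g.
by exists c => //; exists (d * b); rewrite ?mulgA.
Qed.

Lemma set_pow_le W j k :
  W 1 -> (j <= k)%N -> set_pow W j `<=` set_pow W k.
Proof.
move=> W1 /subnKC <- a Wa; rewrite -[a]mulg1; apply: set_powD => //.
elim: (k - j)%N => //= i Wi.
by exists 1 => //; exists 1; rewrite ?mulg1.
Qed.

Lemma set_pow_section W k a x : (forall b y, W b -> W (letter_section b y)) ->
  set_pow W k a -> set_pow W k (letter_section a x).
Proof.
move=> WS; elim: k a x => [_ x ->|k IH _ x [b Wb [c Wc] <-]] /=.
  by have [_] := letter_act1 x.
have [_ ->] := letter_actM b c x.
exists (letter_section b (letter_act c x)); first exact: WS.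
by exists (letter_section c x) => //; apply: IH.
Qed.

Lemma finite_short_words n : finite_set [set v : seq X | (size v <= n)%N].
Proof.
apply: (@sub_finite_set _ _ ((@bseqval n X) @` [set: n.-bseq X])).
  by move=> v /= vn; exists (Bseq vn).
exact: finite_image.
Qed.

Lemma contracting_section_closed N (T : seq G) : contracting_set X N ->
  exists W : set G, [/\ finite_set W, {in T, forall t, W t}, N `<=` W
    & forall b y, W b -> W (letter_section b y)].
Proof.
case=> Nfin; have /finite_seqP[s ->] := Nfin => sP.
have [m mP] : exists m, {in T ++ s, forall t n, (m <= n)%N ->
    forall v, size v = n -> section t v \in s}.
  apply: uniform_bound => t _; have [m mP] := sP t.
  by exists m => n mn v vn; apply: mP; rewrite vn.
(* Depth [m] suffices: one letter further, a section is already an entry of [s], hence its own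
   section at the empty word. *)
exists [set section t (v : seq X) | t in [set` T ++ s] &
  v in [set v : seq X | (size v <= m)%N]].
split.
- by apply: finite_image2; [apply: finite_seq|apply: finite_short_words].
- by move=> t tT; exists t; rewrite /= ?mem_cat ?tT //; exists [::].
- move=> t /= tT; exists t; rewrite /= ?mem_cat ?tT ?orbT //; by exists [::].
- move=> _ y [t /= tT [v /= vm] <-].
  have -> : letter_section (section t v) y = section t (v ++ [:: y]).
    by rewrite section_cat.
  have [le|lt] := leqP (size (v ++ [:: y])) m.
    by exists t => //; exists (v ++ [:: y]).
  exists (section t (v ++ [:: y])); last by exists [::].
  by rewrite /= mem_cat; apply/orP; right; apply: mP (ltnW lt) _ _.
Qed.

(* After [p] steps the section halves the length over [W] while the right
   factors contribute at most [p] letters, so lengths stay below [3p]. *)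
Lemma contracting_absorb (T : seq G) : contracting X ->
  exists2 M : seq G, {subset T <= M}
    & forall m x t, m \in M -> t \in T -> letter_section m x * t \in M.
Proof.
move=> [N NP].
have [W [fW TW NW WS]] := contracting_section_closed (1 :: T) NP.
have W1 : W 1 by apply: TW; rewrite inE eqxx.
have {}TW t : t \in T -> W t by move=> tT; apply: TW; rewrite inE tT orbT.
have [_ sP] := NP; have /finite_seqP[s sE] := fW.
(* From depth [p0] on, sections of products of two elements of [W] are back in [W]: this is what
   halves lengths. *)
have [p0 p0P] : exists p, {in [seq a * b | a <- s, b <- s],
    forall c n, (p <= n)%N -> forall v, size v = n -> W (section c v)}.
  apply: uniform_bound => c _; have [m mP] := sP c.
  by exists m => n mn v vn; apply/NW/mP; rewrite vn.
pose p := p0.+1.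
have half k c v : size v = p -> set_pow W k.*2 c -> set_pow W k (section c v).
  elim: k c v => [c v _ ->|k IH c v vp] /=; first by rewrite section1.
  move=> [a Wa [_ [b Wb [d Wd] <-]] <-].
  rewrite mulgA sectionM; exists (section (a * b) (word_act d v)).
    apply: (p0P _ _ p); rewrite ?size_word_act // /p //.
    apply/flatten_mapP; exists a; first by move: Wa; rewrite sE.
    by apply/mapP; exists b => //; move: Wb; rewrite sE.
  by exists (section d v) => //; apply: IH.
have secP k c v : set_pow W k c -> set_pow W k (section c v).
  by elim: v c => //= x v IH c Wc; apply: IH; apply: set_pow_section.
pose M : set G := [set g | exists c v r j, [/\ (j < p)%N, size v = j,
  set_pow W p.*2 c, set_pow W j r & g = section c v * r]].
have /finite_seqP[M' ME] : finite_set M.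
  apply: (@sub_finite_set _ _ (set_pow W (p.*2 + p))).
    move=> _ [c [v [r [j [jp vj Wc Wr ->]]]]].
    apply: set_powD; first exact: secP.
    by apply: (set_pow_le W1 (ltnW jp)).
  exact: finite_set_pow.
have MM g : M g -> g \in M' by rewrite ME.
exists M' => [t tT|m x t mM tT].
  apply: MM; exists t, [::], 1, 0; split=> //; last by rewrite mulg1.
  apply: (@set_pow_le W 1) => //; exists t; first exact: TW.
  by exists 1; rewrite ?mulg1.
have : M m by rewrite ME.
move=> [c [v [r [j [jp vj Wc Wr ->]]]]]; apply: MM.
pose r' := letter_section r x * t.
have Wr' : set_pow W j.+1 r'.
  rewrite -addn1; apply: set_powD; first exact: set_pow_section.
  by exists t; [apply: TW|exists 1; rewrite ?mulg1].
have -> : letter_section (section c v * r) x * t =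
    section c (v ++ [:: letter_act r x]) * r'.
  by have [_ ->] := letter_actM (section c v) r x; rewrite section_cat mulgA.
have sv : size (v ++ [:: letter_act r x]) = j.+1.
  by rewrite size_cat vj addn1.
have [jp'|pj] := ltnP j.+1 p.
  by exists c, (v ++ [:: letter_act r x]), r', j.+1.
(* At depth [p] the section of [c] has length [p] instead of [2p]; with the [p] letters gathered in
   [r'] it forms a word of length [2p] again, and the depth restarts at 0. *)
have jpE : j.+1 = p by apply/eqP; rewrite eqn_leq jp pj.
exists (section c (v ++ [:: letter_act r x]) * r'), [::], 1, 0.
split=> //; last by rewrite mulg1.
rewrite -addnn; apply: set_powD; last by rewrite -jpE.
by apply: half => //; rewrite sv.
Qed.

Section SelfReplicating.
Hypothesis sX : self_replicating X.

Lemma self_replicating_lift v h :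
  exists2 g, word_act g v = v & section g v = h.
Proof.
elim: v h => [|x v IH] h; first by exists h.
have [g gv gs] := IH h; have [k kx ks] := sX.2 x g.
by exists k => /=; rewrite ?kx ks ?gv.
Qed.

(** By self-replication [h] is the section of some word in [U] at a vertex of depth [m]; there each
    letter of the word contributes a section in [N]. *)
Lemma contracting_generates N U : fin_gen [set: G] U -> faithful X ->
  contracting_set X N -> generated N = [set: G].
Proof.
move=> [_ _ UG] fX [_ NP]; rewrite -subTset => h _.
have [g1 gM gV] := generated_subgroup N.
have [[x _]|X0] := pselect (exists x : X, True); last first.
  have -> // : h = 1; apply: fX => -[//|x w].
  by case: X0; exists x.
have [m mP] : exists m, {in U, forall u n, (m <= n)%N ->
    forall v, size v = n -> N (section u v)}.
  apply: uniform_bound => u _; have [m mP] := NP u.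
  by exists m => n mn v vn; apply: mP; rewrite vn.
have [g _ <-] := self_replicating_lift (nseq m x) h.
have [s sU ->] := UG g I.
have: size (nseq m x) = m by rewrite size_nseq.
elim: s sU (nseq m x) => [|u s IH] sU v vm.
  by rewrite big_nil section1.
rewrite big_cons sectionM; apply: gM.
  apply: sub_generated; apply: (mP u _ m) => //; rewrite ?size_word_act //.
  by apply: sU; rewrite inE eqxx.
by apply: IH => // z zs; apply: sU; rewrite inE zs orbT.
Qed.

(* Induction on [v]: a word with section [t] at the last letter is lifted
   letter by letter along the remaining prefix of [v]. *)
Lemma bounded_lift S : fin_gen [set: G] S -> contracting X ->
  exists M : seq G, forall v t, t \in S -> exists w : seq G,
    [/\ {subset w <= S}, word_act (\prod_(h <- w) h) v = v,
        section (\prod_(h <- w) h) v = t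
      & forall i, section (\prod_(h <- drop i w) h) v \in M].
Proof.
move=> [_ _ SG] cX; pose P w : G := \prod_(h <- w) h.
(* [T0] collects the partial sections, at single letters, of chosen lifts of the generators. *)
have [T0 T0P] : exists T0 : seq G, {in enum X, forall x, {in S, forall t,
    exists w : seq G, [/\ {subset w <= S}, letter_act (P w) x = x,
      letter_section (P w) x = t
      & forall i, letter_section (P (drop i w)) x \in T0]}}.
  apply: uniform_seq => [x M M' MM' H t /H|x _].
    by move=> [w [? ? ? wM]]; exists w; split=> // i; apply/MM'/wM.
  apply: uniform_seq => [t M M' MM' [w [? ? ? wM]]|t _].
    by exists w; split=> // i; apply/MM'/wM.
  have [g gx gt] := sX.2 x t; have [w wS gE] := SG g I.
  exists [seq letter_section (P (drop i w)) x | i <- iota 0 (size w).+1], w.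
  rewrite /P -gE; split=> // i; apply/mapP; exists (minn i (size w)).
    by rewrite mem_iota /= add0n ltnS geq_minr.
  case: leqP => // iw; rewrite drop_size drop_oversize //; exact: ltnW.
have [M TM MS] := contracting_absorb (1 :: S ++ T0) cX.
exists M; elim/last_ind => [t tS|v x IH t tS].
  exists [:: t]; split=> //; rewrite ?big_seq1 //.
    by move=> h; rewrite inE => /eqP ->.
  move=> [|i] /=; rewrite ?big_seq1 ?big_nil; apply: TM.
    by rewrite inE mem_cat tS orbT.
  by rewrite inE eqxx.
have [|z [zS zx zt zT]] := T0P x _ t tS; first by rewrite mem_enum.
have [w [wS wv wz wM]] : exists w, [/\ {subset w <= S}, word_act (P w) v = v,
    section (P w) v = P z & forall i, section (P (drop i w)) (rcons v x) \in M].
  elim: z zS zT {zx zt} => [|s z IHz] zS zT.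
    exists [::]; rewrite /P !big_nil word_act1 section1; split=> // i.
    by rewrite section1; apply: TM; rewrite inE eqxx.
  have [|i|w' [w'S w'v w'z w'M]] := IHz.
  - by move=> h hz; apply: zS; rewrite inE hz orbT.
  - exact: zT i.+1.
  have [|w1 [w1S w1v w1s w1M]] := IH s; first by apply: zS; rewrite inE eqxx.
  exists (w1 ++ w'); rewrite /P big_cat /= -!/(P _); split.
  - by move=> h; rewrite mem_cat => /orP[/w1S|/w'S].
  - by rewrite word_actM w'v.
  - by rewrite sectionM w'v w'z w1s /P big_cons.
  (* Inside [w1], the partial section at [rcons v x] is a one-letter section of an element of [M]
     times the section of [P z] at [x], which lies in [T0]; [M] absorbs this product. *)
  - move=> i; rewrite drop_cat; case: ltnP => _; last exact: w'M.
    rewrite big_cat /= -!/(P _) -cats1 section_cat sectionM w'v w'z /=.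
    have [_ ->] := letter_actM (section (P (drop i w1)) v) (P z) x.
    apply: MS; first exact: w1M.
    by have := zT 1%N; rewrite /= drop0 inE mem_cat => ->; rewrite !orbT.
exists w; split=> //; rewrite -/(P w) -cats1.
  by rewrite word_act_cat wv wz /= zx.
by rewrite section_cat wz /= zt.
Qed.

End SelfReplicating.
End Contraction.

(** * Orbits, almost invariant sets and their boundaries *)

Section GroupActions.
Local Open Scope classical_set_scope.
Local Open Scope group_scope.
Context {G : groupType} {Y : choiceType} (act : G -> Y -> Y).
Hypothesis actP : is_action act.
Implicit Types (g h l q : G) (L Q K H : set G) (U V w : seq G).
Implicit Types (x y z p e : Y) (a : pred Y).

Lemma act1 y : act 1 y = y. Proof. exact: actP.1. Qed.
Lemma actM g h y : act (g * h) y = act g (act h y). Proof. exact: actP.2. Qed.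
Lemma actK g y : act g^-1 (act g y) = y. Proof. by rewrite -actM mulVg act1.
  Qed.
Lemma actVK g y : act g (act g^-1 y) = y. Proof. by rewrite -actM mulgV act1.
  Qed.
Lemma act_inj g y z : act g y = act g z -> y = z.
Proof. by move=> E; rewrite -(actK g y) E actK. Qed.

Definition almost_invariant a :=
  forall g, finite_set [set y | a y != a (act g y)].

(** The vertex boundary of [a] in the Schreier graph with edges given by [U]. *)
Definition boundary U a : set Y := [set p | exists2 u,
  u \in U & a p != a (act u p)].

Definition act_orbit L y : set Y := [set act l y | l in L].

Lemma almost_invariantN a : almost_invariant a -> almost_invariant (predC a).
Proof.
move=> aA g; apply: sub_finite_set (aA g) => y /=.
by case: (a y); case: (a _).
Qed.

Lemma boundaryN U a : boundary U (predC a) = boundary U a.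
Proof.
apply/seteqP; split=> p [u uU /= H]; exists u => //=; move: H.
  by case: (a p); case: (a _).
by case: (a p); case: (a _).
Qed.

Lemma word_boundary U a w y : {subset w <= U} ->
  a y != a (act (\prod_(h <- w) h) y) ->
  exists i, boundary U a (act (\prod_(h <- drop i w) h) y).
Proof.
move=> wU /eqP ne; apply: contrapT => no; apply: ne.
elim: w wU no => [|u w IH] wU no; first by rewrite big_nil act1.
rewrite IH => [|h hw|[i bi]]; last 2 first.
- by apply: wU; rewrite inE hw orbT.
- by apply: no; exists i.+1.
rewrite big_cons actM; apply/eqP/contraT => ne.
case: no; exists 1%N; rewrite /= drop0; exists u => //.
by apply: wU; rewrite inE eqxx.
Qed.

Lemma finite_boundary U a : almost_invariant a -> finite_set (boundary U a).
Proof.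
move=> aA; apply: (@sub_finite_set _ _
  (\bigcup_(u in [set` U]) [set p | a p != a (act u p)])).
  by move=> p [u uU H]; exists u.
by apply: bigcup_finite; first exact: finite_seq.
Qed.

Lemma act_orbit_self L y : is_subgroup L -> act_orbit L y y.
Proof. by move=> [L1 _ _]; exists 1; rewrite ?act1. Qed.

Lemma act_orbit_sub L y z : is_subgroup L -> act_orbit L y z ->
  act_orbit L z `<=` act_orbit L y.
Proof.
move=> [_ LM _] [l Ll <-] _ [l' Ll' <-].
by exists (l' * l); [apply: LM|rewrite actM].
Qed.

Lemma act_orbit_sym L y z : is_subgroup L -> act_orbit L y z -> act_orbit L z y.
Proof. by move=> [_ _ LV] [l Ll <-]; exists l^-1; [apply: LV|rewrite actK]. Qed.

Lemma act_orbit_eq L y z : is_subgroup L -> act_orbit L y z ->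
  act_orbit L z = act_orbit L y.
Proof.
move=> LG yz; apply/seteqP; split; first exact: act_orbit_sub.
by apply: act_orbit_sub => //; apply: act_orbit_sym.
Qed.

(** Connectedness of the Schreier graph of an orbit, as an induction principle: what is preserved
    along edges spreads from one point to the orbit. *)
Lemma act_orbit_ind L U y (W : set Y) : fin_gen L U -> is_subgroup L ->
  (forall p, act_orbit L y p -> W p -> forall u, u \in U -> W (act u p)) ->
  forall p, act_orbit L y p -> W p -> forall z, act_orbit L y z -> W z.
Proof.
move=> [UL _ Lgen] LG WU p yp Wp z yz.
have : act_orbit L p z by rewrite (act_orbit_eq LG yp).
have [L1 LM _] := LG; case=> l /Lgen [s sU ->] <-.
suff [] : W (act (\prod_(h <- s) h) p) /\
  act_orbit L y (act (\prod_(h <- s) h) p) by [].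
elim: s sU => [|u s IH] sU; first by rewrite big_nil act1.
have [|Ws os] := IH; first by move=> h hs; apply: sU; rewrite inE hs orbT.
have uU : u \in U by apply: sU; rewrite inE eqxx.
rewrite big_cons actM; split; first exact: WU.
by apply: (act_orbit_sub LG os); exists u => //; apply: UL.
Qed.

Lemma act_orbit_const L U y a : fin_gen L U -> is_subgroup L ->
  (forall p, act_orbit L y p -> ~ boundary U a p) ->
  forall z, act_orbit L y z -> a z = a y.
Proof.
move=> LU LG noB z yz.
apply: (act_orbit_ind (W := [set z | a z = a y]) LU LG _ (act_orbit_self y LG)
  _ yz) => //.
move=> p yp /= <- u uU; apply/eqP; rewrite eq_sym; apply/negPn/negP => ne.
by apply: (noB p yp); exists u.
Qed.

Lemma finite_translate g (A : set Y) :
  finite_set [set z | A (act g z)] <-> finite_set A.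
Proof.
split=> fA.
  apply: sub_finite_set (finite_image (act g) fA) => z Az.
  by exists (act g^-1 z); rewrite /= ?actVK.
apply: sub_finite_set (finite_image (act g^-1) fA) => z Az.
by exists (act g z) => //; rewrite actK.
Qed.

(* Translating [act_orbit L y] by [Q] yields disjoint copies on each of which
  [a]
   is again finite, and only finitely many of them meet the boundary. *)
Lemma finite_halfspace L Q U y a :
  is_subgroup L -> is_subgroup Q -> fin_gen L U ->
  (forall l q, L l -> Q q -> l * q = q * l) ->
  fin_sep [set: G] [set g | exists2 l, L l & exists2 q, Q q & g = l * q] ->
  (forall z, exists g, act g y = z) -> almost_invariant a ->
  ~ finite_set (act_orbit L y) ->
  finite_set [set z | act_orbit L y z /\ a z] -> finite_set [set z | a z].
Proof.
move=> LG QG LU LQ sD tr aA inf fin.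
have [L1 LM LV] := LG; have [Q1 QM QV] := QG.
have orbq q : Q q -> forall z,
  act_orbit L (act q y) z <-> act_orbit L y (act q^-1 z).
  move=> Qq z; split=> [[l Ll <-]|[l Ll E]]; exists l => //.
    by rewrite -!actM -mulgA (LQ l) // mulKg.
  by rewrite -actM (LQ l) // actM E actVK.
have infq q : Q q -> ~ finite_set (act_orbit L (act q y)).
  move=> Qq fq; apply: inf; apply/(@finite_translate q^-1).
  by apply: sub_finite_set fq => z /orbq; apply.
have finq q : Q q -> finite_set [set z | act_orbit L (act q y) z /\ a z].
  move=> Qq; apply: (@sub_finite_set _ _
    ([set z | a z != a (act q^-1 z)] `|`
     [set z | [set z | act_orbit L y z /\ a z] (act q^-1 z)])).
    move=> z [/orbq-/(_ Qq) oz az] /=;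
      have [E|] := eqVneq (a z) (a (act q^-1 z)).
      by right; rewrite -E.
    by left.
  by rewrite finite_setU; split; [apply: aA|apply/finite_translate].
pose D g := exists2 l, L l & exists2 q, Q q & g = l * q.
have finD : finite_set [set z | act_orbit [set g | D g] y z /\ a z].
  apply: (@sub_finite_set _ _
    (\bigcup_(p in boundary U a `&` act_orbit [set g | D g] y)
      [set z | act_orbit L p z /\ a z])).
    move=> _ [[_ [l Ll [q Qq ->]] <-] az].
    have oz : act_orbit L (act q y) (act (l * q) y) by exists l; rewrite ?actM.
    (* A copy of the orbit missing the boundary would lie entirely in [a], yet it is infinite and
       meets [a] in a finite set. *)
    have [[p [bp op]]|noB] :=
      pselect (exists p, boundary U a p /\ act_orbit L (act q y) p).
      exists p; last by split=> //; rewrite (act_orbit_eq LG op).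
      split=> //; have [l' Ll' <-] := op; exists (l' * q); last by rewrite actM.
      by exists l' => //; exists q.
    case: (infq _ Qq); apply: sub_finite_set (finq _ Qq) => z oz'.
    split=> //; have C := act_orbit_const (a := a) LU LG (y := act q y).
    have {}C := C (fun p op bp => noB (ex_intro _ p (conj bp op))).
    by rewrite C // -(C _ oz).
  apply: bigcup_finite.
    by apply: finite_setIl; apply: finite_boundary.
  move=> _ [_ [_ [l Ll [q Qq ->]] <-]]; rewrite actM.
  rewrite (@act_orbit_eq L (act q y) (act l (act q y))) //; first exact: finq.
  by exists l.
(* Finitely many translates of the orbit of [L Q] cover [Y], and almost invariance transports
   finiteness to each. *)
have [F _ FP] := fin_sep_reps sD.
apply: (@sub_finite_set _ _ (\bigcup_(f in [set` F])
  ([set z | a z != a (act f^-1 z)] `|`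
   [set z | [set z | act_orbit [set g | D g] y z /\ a z] (act f^-1 z)]))).
  move=> z az; have [g gz] := tr z; have [f fF Df] := FP g I.
  exists f => //; have [E|] := eqVneq (a z) (a (act f^-1 z)); last by left.
  right; split; last by rewrite -E.
  by exists (f^-1 * g) => //; rewrite actM gz.
apply: bigcup_finite => [|f _]; first exact: finite_seq.
by rewrite finite_setU; split; [apply: aA|apply/finite_translate].
Qed.

End GroupActions.

Lemma fin_sep_finite (G : groupType) (V : choiceType) (K H : set G) (A : set V)
    (f : G -> V) : finite_set A -> (forall g, K g -> A (f g)) ->
  (forall g h, K g -> K h -> f g = f h -> H (g^-1 * h)%g) -> fin_sep K H.
Proof.
move=> /finite_seqP[s ->] fA fH.
exists 'I_(size s).+1, (fun g => inord (index (f g) s)) => g h Kg Kh E.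
have {}E : index (f g) s = index (f h) s.
  by move/(congr1 val): E; rewrite /= !inordK // ltnS index_size.
by apply: fH => //; rewrite -(nth_index (f g) (fA g Kg)) E nth_index //;
  apply: fA.
Qed.

(** * Displacing the boundary inside one orbit *)

Section TwoEnded.
Local Open Scope classical_set_scope.
Local Open Scope group_scope.
Context {G : groupType} {Y : choiceType} (act : G -> Y -> Y).
Hypothesis actP : is_action act.
Implicit Types (g h l q f u : G) (Q K H : set G) (V w : seq G).
Implicit Types (x z p e : Y) (a : pred Y) (E : seq Y).

Variables (L : set G) (U : seq G) (y : Y).
Hypotheses (LG : is_subgroup L) (LU : fin_gen L U).
Local Notation O := (act_orbit act L y).

Let Uact p u : O p -> u \in U -> O (act u p).
Proof.
move=> Op uU; apply: (act_orbit_sub actP LG Op); exists u => //.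
by case: LU => UL _ _; apply: UL.
Qed.

(** Connectedness is phrased through predicates that do not change along edges starting in [E], the
    form in which it is applied to [a (act f e)]. *)
Definition connected_hull E : Prop :=
  [/\ y \in E, {in E, forall e, O e}
    & forall W : pred Y, {in E, forall e, {in U, forall u,
      W e = W (act u e)}} ->
        {in E, forall e, W e = W y}].

(** Paths from [y] to the points of [s] are joined; all contain [y], so the union stays
    connected. *)
Lemma connected_hull_exists (s : seq Y) : {in s, forall p, O p} ->
  exists2 E, connected_hull E & {subset s <= E}.
Proof.
have word w : {subset w <= U} ->
    exists2 E, connected_hull E & act (\prod_(h <- w) h) y \in E.
  elim: w => [|u w IH] wU.
    exists [:: y]; last by rewrite big_nil (act1 actP) inE.
    split=> [|e|W _ e]; first by rewrite inE.
      by rewrite inE => /eqP ->; apply: act_orbit_self.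
    by rewrite inE => /eqP ->.
  have [|E [yE EO EW] wE] := IH; first by move=> h hw; apply: wU;
    rewrite inE hw orbT.
  have uU : u \in U by apply: wU; rewrite inE eqxx.
  exists (act (\prod_(h <- u :: w) h) y :: E); last by rewrite inE eqxx.
  rewrite big_cons (actM actP); split=> [|e|W WE].
  - by rewrite inE yE orbT.
  - by rewrite inE => /orP[/eqP ->|/EO//]; apply: Uact => //; apply: EO.
  have {}EW : {in E, forall e, W e = W y}.
    by apply: EW => e eE; apply: WE; rewrite inE eE orbT.
  move=> e; rewrite inE => /orP[/eqP ->|/EW//].
  by rewrite -WE ?EW // inE wE orbT.
elim: s => [_|p s IH sO].
  by have [|E hE _] := word [::] => //; exists E.
have [|E [yE EO EW] sE] := IH; first by move=> x xs; apply: sO;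
  rewrite inE xs orbT.
have /sO [l Ll lp] : p \in p :: s by rewrite inE eqxx.
have [_ _ Lgen] := LU; have [w wU lE] := Lgen l Ll.
have [E' [yE' EO' EW'] pE'] := word w wU.
exists (E ++ E').
  split=> [|e|W WE e]; first by rewrite mem_cat yE.
    by rewrite mem_cat => /orP[/EO|/EO'].
  rewrite mem_cat => /orP[]; [apply: EW|apply: EW'] => e' e'E; apply: WE.
    by rewrite mem_cat e'E.
  by rewrite mem_cat e'E orbT.
move=> x; rewrite inE mem_cat => /orP[/eqP->|/sE -> //].
by rewrite -lp lE pE' orbT.
Qed.

Section Displacement.
Variable E : seq Y.
Hypothesis hE : connected_hull E.

Definition displaces f := [/\ forall l, L l -> l * f = f * l, O (act f y)
  & {in E, forall e, act f e \notin E}].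

Lemma displaces_orbit f p : displaces f -> O p -> O (act f p).
Proof.
move=> [fL fO _] [l Ll <-]; rewrite -(actM actP) -fL // (actM actP).
by apply: (act_orbit_sub actP LG fO); exists l.
Qed.

Lemma displacesV f : displaces f -> displaces f^-1.
Proof.
move=> [fL fO fE]; have fL' l : L l -> l * f^-1 = f^-1 * l.
  by move=> Ll; rewrite -[in RHS](mulgK f l) fL // !mulgA mulVg mul1g.
split=> //.
  have [l Ll lf] := act_orbit_sym actP LG fO; exists l => //.
  by rewrite -[in RHS]lf -(actM actP) -fL' // -(actM actP) mulgVK.
by move=> e eE; apply/negP => /fE; rewrite (actVK actP) eE.
Qed.

Variable a : pred Y.
Hypotheses (aA : almost_invariant act a)
  (aE : forall p, boundary act U a p -> O p -> p \in E).

(** As [f] commutes with [U], edges at [e] are carried to edges at [act f e], which lies outside [E]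
    and so off the boundary; connectedness of [E] does the rest. *)
Lemma displaces_const f : displaces f -> {in E, forall e,
  a (act f e) = a (act f y)}.
Proof.
move=> fD; have [fL _ fE] := fD; have [_ EO EW] := hE.
apply: (EW (fun e => a (act f e))) => e eE u uU /=.
apply/eqP/negPn/negP => ne; have /negP := fE e eE; apply; apply: aE.
  exists u => //; apply: contraNN ne => /eqP ->; rewrite -!(actM actP) fL //.
  by case: LU => UL _ _; apply: UL.
by apply: displaces_orbit => //; apply: EO.
Qed.

Let boundaryVE p u : O p -> u \in U -> a p != a (act u p) -> p \in E.
Proof. by move=> Op uU ne; apply: aE => //; exists u. Qed.

Let actV_comm f u p : displaces f -> u \in U ->
  act f^-1 (act u p) = act u (act f^-1 p).
Proof.
move=> /displacesV[fL _ _] uU; rewrite -!(actM actP) fL //.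
by case: LU => UL _ _; apply: UL.
Qed.

(* If both [f] and its inverse push [E] into [a], then [a] and [f a] cover the
   orbit, so the complement of [a] lies in [f a \ a], which is finite. *)
Lemma displaces_not_both f : displaces f ->
  (exists2 p, O p & a p) -> ~ finite_set [set p | O p /\ ~~ a p] ->
  a (act f y) -> a (act f^-1 y) -> False.
Proof.
move=> fD [p1 Op1 ap1] inf afy afVy; apply: inf.
have fVD := displacesV fD.
apply: sub_finite_set (aA f^-1) => p [Op /negbTE ap] /=.
rewrite ap; have [//|/negbTE afp] := boolP (a (act f^-1 p)).
have : [set z | ~~ a z /\ ~~ a (act f^-1 z)] p1; last by rewrite /= ap1; case.
apply: (act_orbit_ind actP LU LG _ Op _ Op1); last by rewrite /= ap afp.
move=> {Op ap afp} {}p Op [/= /negbTE ap /negbTE afp] u uU; split.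
  apply/negP => aup; have pE : p \in E by apply: boundaryVE uU _;
    rewrite // ap aup.
  by have := displaces_const fVD pE; rewrite afp afVy.
apply/negP; rewrite actV_comm // => aup.
have pE : act f^-1 p \in E.
  by apply: boundaryVE uU _; rewrite ?afp ?aup //; apply: displaces_orbit.
by have := displaces_const fD pE; rewrite (actVK actP) ap afy.
Qed.

Section Translation.
Variable f : G.
Hypotheses (fD : displaces f) (afy : a (act f y)) (afVy : ~~ a (act f^-1 y)).

(** Were a point of [a] sent out of [a], the set of [z] outside [a] with [act f^-1 z] in [a] would
    be nonempty and closed under edges, hence the whole orbit, although [a] meets the orbit. *)
Lemma displaces_mono : (exists2 p, O p & a p) ->
  forall p, O p -> a p -> a (act f p).
Proof.
move=> [p1 Op1 ap1] p0 Op0 ap0; apply/negPn/negP => /negbTE afp0.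
have fVD := displacesV fD; have Ofp0 := displaces_orbit fD Op0.
have [p2 [Op2 H2]] : exists p, O p /\ ~ (~~ a p /\ a (act f^-1 p)).
  by exists p1; rewrite ap1; split=> // -[].
apply: H2; have : [set z | ~~ a z /\ a (act f^-1 z)] p2; last by [].
apply: (act_orbit_ind actP LU LG _ Ofp0 _ Op2);
  last by rewrite /= afp0 (actK actP).
move=> p Op [/= /negbTE ap afp] u uU; split.
  apply/negP => aup; have pE : p \in E by apply: boundaryVE uU _;
    rewrite // ap aup.
  by have := displaces_const fVD pE; rewrite afp (negbTE afVy).
apply/negPn/negP; rewrite actV_comm // => /negbTE aup.
have pE : act f^-1 p \in E.
  by apply: boundaryVE uU _; rewrite ?afp ?aup //; apply: displaces_orbit.
by have := displaces_const fD pE; rewrite (actVK actP) ap afy.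
Qed.

(** If a power of [f] brings [p] into [a] but none brings in its neighbour [act u p], all further
    images of [p] are boundary points; they are pairwise distinct, contradicting finiteness. *)
Lemma displaces_expand : (exists2 p, O p & a p) ->
  (exists2 p, O p & boundary act U a p) ->
  forall p, O p -> exists j, a (act (f ^+ j) p).
Proof.
move=> aO [p0 Op0 [u0 u0U p0u]]; have mono := displaces_mono aO.
have [fL fO _] := fD.
have fj j p : O p -> O (act (f ^+ j) p).
  move=> Op; elim: j => [|j IH]; first by rewrite expg0 (act1 actP).
  by rewrite expgS (actM actP); apply: displaces_orbit.
have fjL j l : L l -> l * f ^+ j = f ^+ j * l.
  by move=> Ll; apply: commuteX; apply: fL.
have up j i p : O p -> a (act (f ^+ j) p) -> a (act (f ^+ (i + j)) p).
  move=> Op aj; elim: i => // i IH; rewrite addSn expgS (actM actP).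
  by apply: mono => //; apply: fj.
have [e0 e0E ae0] : exists2 e, e \in E & ~~ a e.
  have [a0|na0] := boolP (a p0); last first.
    by exists p0 => //; apply: aE => //; exists u0.
  have Ou := Uact Op0 u0U.
  exists (act u0 p0); last by move: p0u; rewrite a0; case: (a _).
  apply: aE => //; exists u0^-1; first by case: LU => _ UV _; apply: UV.
  by rewrite (actK actP) eq_sym.
have Oe0 : O e0 by case: hE => _ EO _; apply: EO.
(* If a power of [f] fixes one point, it fixes the whole orbit and so [e0]; but all forward images
   of [e0] lie in [a]. *)
have free j p : O p -> act (f ^+ j.+1) p <> p.
  move=> Op fix_p.
  have : act (f ^+ j.+1) e0 = e0.
    have : act_orbit act L p e0 by rewrite (act_orbit_eq actP LG Op).
    by case=> l Ll <-; rewrite -(actM actP) -fjL // (actM actP) fix_p.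
  have := up 1%N j e0 Oe0; rewrite expg1 addn1 => /[swap] ->.
  by rewrite displaces_const // afy (negbTE ae0) => /(_ isT).
have [p1 Op1 ap1] := aO.
move=> p Op; have : [set z | exists j, a (act (f ^+ j) z)] p; last by [].
apply: (act_orbit_ind actP LU LG _ Op1 _ Op); last by exists 0;
  rewrite expg0 (act1 actP).
move=> {Op1 ap1 p1 Op} {}p Op [j0 aj0] u uU.
apply: contrapT => /forallNP no.
have /finite_seqP[s sE] := finite_boundary U aA.
pose t := [seq act (f ^+ (i + j0)) p | i <- iota 0 (size s).+1].
have : (size t <= size s)%N; last by rewrite size_map size_iota ltnn.
apply: uniq_leq_size.
  rewrite map_inj_in_uniq ?iota_uniq // => i j _ _.
  wlog ij : i j / (i <= j)%N.
    by move=> H; have [/H//|/ltnW/H h E'] := leqP i j; apply/esym/h.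
  rewrite leq_eqVlt in ij; case/orP: ij => [/eqP//|ij].
  move=> fij; exfalso; apply: (free (j - i.+1)%N (act (f ^+ (i + j0)) p)).
    exact: fj.
  rewrite -(actM actP) -expgnDr addnA addSnnS subnK //.
move=> _ /mapP[i _ ->].
suff : boundary act U a (act (f ^+ (i + j0)) p) by rewrite sE.
exists u => //; rewrite up // -(actM actP).
have -> : u * f ^+ (i + j0) = f ^+ (i + j0) * u.
  by apply: fjL; case: LU => UL _ _; apply: UL.
by rewrite (actM actP); have /negP/negbTE-> := no (i + j0)%N.
Qed.

End Translation.
End Displacement.
End TwoEnded.

(** * A commuting pair of groups with infinite orbits *)

Section CommutingPair.
Local Open Scope classical_set_scope.
Local Open Scope group_scope.
Context {G : groupType} {Y : choiceType} (act : G -> Y -> Y).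
Hypothesis actP : is_action act.
Implicit Types (g h l q f u : G) (K H : set G) (V w : seq G).
Implicit Types (x z p e : Y).

Lemma centralizer_subgroup (S : set G) :
  is_subgroup [set g | forall s, S s -> s * g = g * s].
Proof.
split=> [s _|g h Hg Hh s Ss|g Hg s Ss]; first by rewrite mulg1 mul1g.
  by rewrite mulgA Hg // -!mulgA Hh.
by apply: (@mulgI _ g); rewrite mulVKg mulgA -Hg // mulgK.
Qed.

Variables (L Q : set G) (U : seq G) (y : Y) (a : pred Y).
Hypotheses (LG : is_subgroup L) (QG : is_subgroup Q) (LU : fin_gen L U).
Hypothesis LQ : forall l q, L l -> Q q -> l * q = q * l.
Hypothesis sD :
  fin_sep [set: G] [set g | exists2 l, L l & exists2 q, Q q & g = l * q].
Hypothesis aA : almost_invariant act a.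
Hypothesis meets : forall q, Q q ->
  exists p, boundary act U a p /\ act_orbit act L (act q y) p.
Local Notation O := (act_orbit act L y).

Let QO : set G := [set q | Q q /\ O (act q y)].

Let QO_orbit q p : QO q -> O p -> O (act q p).
Proof.
move=> [Qq Oq] [l Ll <-]; rewrite -(actM actP) -LQ // (actM actP).
by apply: (act_orbit_sub actP LG Oq); exists l.
Qed.

Let QO_subgroup : is_subgroup QO.
Proof.
have [Q1 QM QV] := QG; split.
- by split=> //; rewrite (act1 actP); apply: act_orbit_self.
- move=> q q' Hq Hq'; split; first by apply: QM; [case: Hq|case: Hq'].
  by rewrite (actM actP); apply: QO_orbit => //; case: Hq'.
- move=> q [Qq Oq]; split; first exact: QV.
  have [l Ll lq] := act_orbit_sym actP LG Oq; exists l => //.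
  by rewrite -[in RHS]lq -(actM actP) -LQ ?(actM actP) ?(actK actP) //;
    apply: QV.
Qed.

(** The translates of [O] by [Q] are [L]-orbits, each meeting the finite boundary; a boundary point
    in the translate determines the coset. *)
Let fin_sep_QO : fin_sep Q QO.
Proof.
have [/= f fP] : {f : G -> Y & forall q, Q q ->
    boundary act U a (f q) /\ act_orbit act L (act q y) (f q)}.
  apply: (@choice _ _ (fun q p => Q q ->
    boundary act U a p /\ act_orbit act L (act q y) p)) => q.
  have [/meets[p pP]|nQ] := pselect (Q q); first by exists p.
  by exists y.
apply: (fin_sep_finite (finite_boundary U aA) (f := f)).
  by move=> q /fP[].
move=> q q' Qq Qq' E; have [_ _ QV] := QG; have [_ QM _] := QG; split.
  by apply: QM => //; apply: QV.
have [_ o1] := fP q Qq; have [_ o2] := fP q' Qq'.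
have : act_orbit act L (act q y) (act q' y).
  by rewrite -(act_orbit_eq actP LG o1) E; apply: act_orbit_sym.
case=> l Ll lE; exists l => //.
by rewrite (actM actP) -lE -(actM actP l) (LQ Ll Qq) (actM actP) (actK actP).
Qed.

Section Translation.
Variables (E : seq Y) (f : G).
Hypotheses (hE : connected_hull act L U y E)
  (aE : forall p, boundary act U a p -> O p -> p \in E)
  (fQ : QO f) (fD : displaces act L y E f).
Hypotheses (afy : a (act f y)) (afVy : ~~ a (act f^-1 y)).
Hypotheses (a_in : exists2 p, O p & a p) (a_out : exists2 p, O p & ~~ a p).

Let C := generated [set f].
(** The points where an [f]-orbit enters [a]: a finite set that meets every [C]-orbit in [O]. *)
Let D : set Y := [set p | [/\ O p, a p & ~~ a (act f^-1 p)]].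

Let CG : is_subgroup C. Proof. exact: generated_subgroup. Qed.
Let Cf : C f. Proof. exact: sub_generated. Qed.

Let CQO : C `<=` QO.
Proof. by apply: generated_min => // _ ->. Qed.

Let LC l c : L l -> C c -> l * c = c * l.
Proof. by move=> Ll /CQO[Qc _]; apply: LQ. Qed.

Let CC c c' : C c -> C c' -> c * c' = c' * c.
Proof.
move=> Cc Cc'.
have fC g : C g -> f * g = g * f.
  move=> Cg; have H : C `<=` [set g | forall s, [set f] s -> s * g = g * s].
    by apply: generated_min (centralizer_subgroup _) _ => _ -> _ ->.
  exact: H.
have H : C `<=` [set g | forall s, C s -> s * g = g * s].
  by apply: generated_min (centralizer_subgroup _) _ => _ -> s /fC.
exact: H.
Qed.

Let CX j : C (f ^+ j).
Proof.
by have [C1 CM _] := CG; elim: j => // j IH; rewrite expgS; apply: CM.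
Qed.

(* Along the [f]-orbit of [p] the predicate [a] switches from false to true,
   and it does so at a point of [D]. *)
Let C_to_D p : O p -> exists d, D d /\ exists2 c, C c & d = act c p.
Proof.
move=> Op; have [_ CM CV] := CG.
have [p0 [Op0 bp0]] : exists p0, O p0 /\ boundary act U a p0.
  have [Q1 _ _] := QG.
  by have [p0 [b o]] := meets Q1; exists p0; rewrite (act1 actP) in o.
have bd : exists2 p0, O p0 & boundary act U a p0 by exists p0.
have fVD := displacesV actP LG fD.
have aNE p1 : boundary act U (predC a) p1 -> O p1 -> p1 \in E.
  by rewrite boundaryN; apply: aE.
have [j aj] := displaces_expand actP LG LU hE aA aE fD afy afVy a_in bd Op.
have [i ai] : exists i, ~~ a (act (f^-1 ^+ i) p).
  apply: (displaces_expand actP LG LU hE (almost_invariantN aA) aNE fVD) => //=.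
  - by rewrite invgK afy.
  - by exists p0; rewrite ?boundaryN.
have ex : exists k, a (act (f ^+ k * f^-1 ^+ i) p).
  exists (i + j)%N; rewrite addnC expgnDr expVgn mulgK.
  exact: aj.
have Ci : C (f^-1 ^+ i) by rewrite expVgn; apply: CV.
(* The walk starts outside [a], so the least exponent is positive and the point before it is still
   outside. *)
case: (ex_minnP ex) => -[|k] ak kmin.
  by move: ak; rewrite expg0 mul1g (negbTE ai).
exists (act (f ^+ k.+1 * f^-1 ^+ i) p); split; last first.
  by exists (f ^+ k.+1 * f^-1 ^+ i) => //; apply: CM.
split=> //; first by apply: QO_orbit => //; apply: CQO; apply: CM.
rewrite expgS -mulgA (actM actP) (actK actP).
by apply/negP => /kmin; rewrite ltnn.
Qed.

(** Elements acting on the [C]-orbit of [y] as translations by an element of [C]. Since [C] is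
    commutative these translations commute, so commutators in [B0] fix [y]. *)
Let B0 : set G := [set g | exists2 z, C z &
  forall c, C c -> act (g * c) y = act (c * z) y].

Let B0_subgroup : is_subgroup B0.
Proof.
have [C1 CM CV] := CG; split.
- by exists 1 => // c _; rewrite mul1g mulg1.
- move=> g h [z Cz gz] [z' Cz' hz]; exists (z * z'); first exact: CM.
  move=> c Cc; rewrite -mulgA (actM actP g) hz // -(actM actP g) gz;
    last exact: CM.
  by rewrite (CC Cz) ?mulgA.
- move=> g [z Cz gz]; exists z^-1; first exact: CV.
  move=> c Cc; have := gz (c * z^-1) (CM _ _ Cc (CV _ Cz)).
  rewrite mulgVK => E1; rewrite (actM actP g^-1) -E1 -(actM actP).
  by rewrite mulKg.
Qed.

Let B0_commg g h : B0 g -> B0 h -> act [~ g, h] y = y.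
Proof.
move=> [z Cz gz] [z' Cz' hz]; have [C1 CM CV] := CG.
have gE c : C c -> act g (act c y) = act (c * z) y by rewrite -(actM actP);
  apply: gz.
have hE' c : C c -> act h (act c y) = act (c * z') y.
  by rewrite -(actM actP); apply: hz.
have ghE : act g (act h y) = act h (act g y).
  have := hE' 1 C1; rewrite (act1 actP) mul1g => ->; rewrite gE //.
  by have := gE 1 C1; rewrite (act1 actP) mul1g => ->; rewrite hE' // CC.
rewrite /commg /conjg (actM actP) (actM actP h^-1) (actM actP g) ghE.
by rewrite (actK actP) (actK actP).
Qed.

Let B0_L l (z : G) : L l -> C z -> act l y = act z y -> B0 l.
Proof.
move=> Ll Cz lz; exists z => // c Cc.
by rewrite (LC Ll Cc) (actM actP) lz -(actM actP).
Qed.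

Let B0_QO q (z : G) : QO q -> C z -> act q y = act z y -> B0 q.
Proof.
move=> [Qq Oq] Cz qz; exists z => // c Cc.
have [Qc [l Ll lc]] := CQO Cc.
rewrite (actM actP) -lc -(actM actP) -(LQ Ll Qq) (actM actP) qz.
by rewrite -(actM actP) (LC Ll Cz) (actM actP) lc -(actM actP) (CC Cz).
Qed.

(** A coding argument: an element of [L Q] is written as [l r q] with [r] one of finitely many
    representatives and [q] in [QO]; then [r] and the points of [D] reached from [l y] and [q^-1 y]
    determine it modulo [B0]. *)
Lemma translation_finite_index : exists B : set G, [/\ is_subgroup B,
  fin_sep [set: G] B & forall g h, B g -> B h -> act [~ g, h] y = y].
Proof.
exists B0; split=> //; pose D0 g := exists2 l, L l & exists2 q, Q q & g = l * q.
have [L1 LM LV] := LG; have [Q1 QM QV] := QG; have [C1 CM CV] := CG.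
have [_ QOM QOV] := QO_subgroup; have [_ BM _] := B0_subgroup.
have DG : is_subgroup [set g | D0 g].
  split.
  - by exists 1 => //; exists 1; rewrite ?mulg1.
  - move=> _ _ [l Ll [q Qq ->]] [l' Ll' [q' Qq' ->]].
    exists (l * l'); first exact: LM; exists (q * q'); first exact: QM.
    by rewrite !mulgA; congr (_ * _); rewrite -!mulgA (LQ Ll').
  - move=> _ [l Ll [q Qq ->]]; exists l^-1; first exact: LV.
    by exists q^-1; [apply: QV|rewrite invgM (LQ (LV _ Ll) (QV _ Qq))].
apply: (fin_sep_trans DG sD).
have [F FQ FP] := fin_sep_reps fin_sep_QO.
have [dec decP] : {dec : G -> G * G * G & forall g, D0 g ->
    [/\ L (dec g).1.1, (dec g).1.2 \in F, QO (dec g).2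
      & g = (dec g).1.1 * ((dec g).1.2 * (dec g).2)]}.
  apply: (@choice _ _ (fun g d => D0 g ->
    [/\ L d.1.1, d.1.2 \in F, QO d.2 & g = d.1.1 * (d.1.2 * d.2)])) => g.
  have [[l Ll [q Qq gE]]|nD] := pselect (D0 g); last by exists (1, 1, 1).
  have [r rF Hr] := FP q Qq; exists (l, r, r^-1 * q) => _; split=> //=.
  by rewrite mulVKg.
have [dl dlP] : {dl : Y -> Y & forall p, O p ->
    D (dl p) /\ exists2 c, C c & dl p = act c p}.
  apply: (@choice _ _ (fun p d =>
    O p -> D d /\ exists2 c, C c & d = act c p)) => p.
  by have [/C_to_D[d dP]|nO] := pselect (O p); [exists d|exists p].
have finD : finite_set D.
  apply: sub_finite_set (aA f^-1) => p [Op ap /negbTE afp] /=.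
  by rewrite ap afp.
pose V := (G * Y * Y)%type.
(* The last factor is coded through its inverse because quotients become
   [(l^-1 * l') * (p^-1 * p')], so that [p^-1 y] and [p'^-1 y] have to lie in one [C]-orbit. *)
pose code g : V := ((dec g).1.2, dl (act (dec g).1.1 y),
  dl (act (dec g).2^-1 y)).
pose A : set V := [set v | [/\ v.1.1 \in F, D v.1.2 & D v.2]].
apply: (@fin_sep_finite _ _ _ _ A code).
- apply: (@sub_finite_set _ _ ([set` F] `*` D `*` D)).
    by move=> v [].
  by apply: finite_setX => //; apply: finite_setX => //; apply: finite_seq.
- move=> g /decP[Ll rF Hq _]; split=> //=.
    by have [] := dlP (act (dec g).1.1 y); first by exists (dec g).1.1.
  by have [] := dlP (act (dec g).2^-1 y); first by case: (QOV _ Hq).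
move=> g h /decP[] + + + + /decP[].
rewrite /code; case: (dec g) => -[l r] p; case: (dec h) => -[l' r'] p' /=.
move=> Ll rF Hp -> Ll' _ Hp' -> [<-] El Ep.
have -> : (l * (r * p))^-1 * (l' * (r * p')) = (l^-1 * l') * (p^-1 * p').
  have Lm : L (l^-1 * l') by apply: LM => //; apply: LV.
  have Qr : Q (r * p) by apply: QM; [apply: FQ|case: Hp].
  rewrite invgM; transitivity ((r * p)^-1 * (l^-1 * l') * (r * p')).
    by rewrite !mulgA.
  by rewrite -(LQ Lm (QV _ Qr)) invgM !mulgA mulgVK.
apply: BM.
  have [|_ [c Cc cE]] := dlP (act l y); first by exists l.
  have [|_ [c' Cc' cE']] := dlP (act l' y); first by exists l'.
  have Cz : C (c'^-1 * c) by apply: CM => //; apply: CV.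
  apply: (B0_L _ Cz); first by apply: LM => //; apply: LV.
  have -> : act (l^-1 * l') y = act (l^-1 * (c'^-1 * c) * l) y.
    by rewrite -!mulgA !(actM actP) -cE El cE' (actK actP).
  by rewrite (LC (LV _ Ll) Cz) mulgVK.
have [|_ [c Cc cE]] := dlP (act p^-1 y); first by case: (QOV _ Hp).
have [|_ [c' Cc' cE']] := dlP (act p'^-1 y); first by case: (QOV _ Hp').
have Cz : C (c^-1 * c') by apply: CM => //; apply: CV.
have Qp : Q p^-1 by apply: QV; case: Hp.
apply: (B0_QO _ Cz); first by apply: QOM => //; apply: QOV.
have [_ [l1 Ll1 l1E]] := QOV _ Hp'.
have p'y : act p' y = act l1^-1 y.
  apply: (act_inj actP (g := l1)); rewrite (actVK actP) -(actM actP) (LQ Ll1);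
    last by case: Hp'.
  by rewrite (actM actP) l1E (actVK actP).
rewrite (actM actP) p'y -(actM actP) -(LQ (LV _ Ll1) Qp) (actM actP).
have -> : act p^-1 y = act (c^-1 * c') (act l1 y).
  by rewrite (actM actP) l1E -cE' -Ep cE (actK actP).
by rewrite -(actM actP _ l1) -(LC Ll1 Cz) (actM actP l1) (actK actP).
Qed.

End Translation.

Lemma two_ended :
  ~ finite_set [set p | O p /\ a p] -> ~ finite_set [set p | O p /\ ~~ a p] ->
  ~ finite_set (act_orbit act Q y) ->
  exists B : set G, [/\ is_subgroup B,
    fin_sep [set: G] B & forall g h, B g -> B h -> act [~ g, h] y = y].
Proof.
move=> inf_a inf_na infQ.
have a_in : exists2 p, O p & a p.
  by have /infinite_setN0[p [Op ap]] := inf_a; exists p.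
have a_out : exists2 p, O p & ~~ a p.
  by have /infinite_setN0[p [Op ap]] := inf_na; exists p.
have /finite_seqP[s sE] : finite_set (boundary act U a `&` O).
  by apply: finite_setIl; apply: finite_boundary.
have [|E hE sub] := connected_hull_exists actP LG LU (s := s) (y := y).
  by move=> p ps; have : [set` s] p by []; rewrite -sE => -[].
have aE p : boundary act U a p -> O p -> p \in E.
  by move=> bp Op; apply: sub; have : [set` s] p by rewrite -sE.
have infQO : ~ finite_set (act_orbit act QO y).
  move=> fQO; apply: infQ; have [F _ FP] := fin_sep_reps fin_sep_QO.
  apply: (@sub_finite_set _ _ [set act f p | f in [set` F] & p in act_orbit
    act QO y]).
    move=> _ [q Qq <-]; have [f fF fq] := FP q Qq; exists f => //.
    exists (act (f^-1 * q) y); first by exists (f^-1 * q).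
    by rewrite -(actM actP) mulVKg.
  by apply: finite_image2 => //; apply: finite_seq.
have [lf lfP] : {lf : Y -> G & forall e, O e -> L (lf e) /\ act (lf e) y = e}.
  apply: (@choice _ _ (fun e l => O e -> L l /\ act l y = e)) => e.
  by have [[l Ll <-]|nO] := pselect (O e); [exists l|exists 1].
(* Otherwise each [q] in [QO] sends some [e] in [E] to a point of [E], and these two points
   determine [act q y], making the orbit finite. *)
have [f fQO fD] : exists2 f, QO f & displaces act L y E f.
  apply: contrapT => no; apply: infQO.
  apply: (@sub_finite_set _ _ [set act (lf e)^-1 e' | e in [set` E] & e' in
    [set` E]]).
    move=> _ [q Hq <-]; apply: contrapT => ne; apply: no; exists q => //.
    have [Qq Oq] := Hq; split=> // [l Ll|e eE]; first exact: LQ.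
    apply/negP => qeE; apply: ne; exists e => //; exists (act q e) => //.
    have [_ EO _] := hE; have [Ll le] := lfP e (EO e eE).
    by rewrite -[in act q e]le -(actM actP q) -LQ // (actM actP (lf e)) (actK
      actP).
  by apply: finite_image2; apply: finite_seq.
have [_ _ QOV] := QO_subgroup; have fVD := displacesV actP LG fD.
have aNE p1 : boundary act U (predC a) p1 -> O p1 -> p1 \in E.
  by rewrite boundaryN; apply: aE.
(* [f] and its inverse cannot push [E] to the same side; in the mixed cases one of them is a
   translation towards [a]. *)
have [afy|nafy] := boolP (a (act f y));
  have [afVy|nafVy] := boolP (a (act f^-1 y)).
- by case: (displaces_not_both actP LG LU hE aA aE fD).
- exact: (translation_finite_index hE aE fQO fD).
- by apply: (translation_finite_index hE aE (QOV _ fQO) fVD); rewrite ?invgK.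
- case: (displaces_not_both actP LG LU hE (almost_invariantN aA) aNE fD) => //=.
  by move=> fin; apply: inf_a; apply: sub_finite_set fin => p [Op ap];
    rewrite /= negbK.
Qed.

End CommutingPair.

(** * Bounding the classes of an invariant equivalence relation *)

Section InvariantEquivalence.
Local Open Scope classical_set_scope.
Local Open Scope group_scope.
Context {G : groupType} {Y : choiceType} (act : G -> Y -> Y).
Hypothesis actP : is_action act.
Variables (S : seq G) (eqv : Y -> Y -> Prop) (a : pred Y) (F : seq Y).
Hypotheses (SG : fin_gen [set: G] S) (tr : forall y z : Y, exists g,
  act g y = z).
Hypotheses (eqv_refl : forall y, eqv y y)
  (eqv_sym : forall y z, eqv y z -> eqv z y)
  (eqv_trans : forall x y z, eqv x y -> eqv y z -> eqv x z)
  (eqv_act : forall g y z, eqv y z -> eqv (act g y) (act g z)).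
Hypothesis aF : forall p, boundary act S a p -> p \in F.

(* A shortest word leading from the class of [y] to that of [z] visits pairwise
   distinct classes; started at the elements of the class of [y] it gives paths
   which cross the boundary of [a] at distinct points. *)
Lemma class_size_bound (y z : Y) (s : seq Y) :
  (forall p, eqv y p -> a p) -> (forall p, eqv z p -> ~~ a p) ->
  uniq s -> {in s, forall p, eqv y p} -> (size s <= size F)%N.
Proof.
move=> ay az us sy; pose P (w : seq G) := \prod_(h <- w) h.
have ex : exists k, `[< exists w, [/\ size w = k, {subset w <= S}
    & eqv z (act (P w) y)] >].
  have [g gy] := tr y z; have [_ _ SP] := SG; have [w wS gE] := SP g I.
  by exists (size w); apply/asboolP; exists w; rewrite /P -gE gy.
have [k /asboolP[w [wk wS wyz]] kmin] := ex_minnP ex.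
have P_drop i : (i <= k)%N -> P w = P (take i w) * P (drop i w).
  by move=> _; rewrite /P -big_cat /= cat_take_drop.
(* Letters act from the right, so a smaller index is a later time: [f p] marks the last step at
   which the path from [p] leaves [a]. *)
have [f fP] : {f : Y -> nat & forall p, p \in s -> [/\ (f p < k)%N,
    a (act (P (drop (f p).+1 w)) p) & ~~ a (act (P (drop (f p) w)) p)]}.
  apply: (@choice _ _ (fun p i => p \in s -> [/\ (i < k)%N,
    a (act (P (drop i.+1 w)) p) & ~~ a (act (P (drop i w)) p)])) => p.
  have [ps|ns] := boolP (p \in s); last by exists 0.
  have exi : exists i, a (act (P (drop i w)) p).
    exists k; rewrite -wk drop_size /P big_nil (act1 actP).
    by apply: ay; apply: sy.
  case: (ex_minnP exi) => -[|i] ai imin.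
    have := az (act (P w) p); rewrite drop0 in ai; rewrite ai => /(_ _)/negP;
      case=> //.
    by apply: eqv_trans wyz _; apply: eqv_act; apply: sy.
  exists i => _; split=> //; last by apply/negP => /imin; rewrite ltnn.
  rewrite ltnNge; apply/negP => ki.
  have := imin k; rewrite -wk drop_size /P big_nil (act1 actP) ay;
    last exact: sy.
  by move=> /(_ isT); rewrite leqNgt wk ltnS ki.
have nth_drop' i : (i < k)%N -> P (drop i w) = nth 1 w i * P (drop i.+1 w).
  by move=> ik; rewrite (drop_nth 1) ?wk // /P big_cons.
pose c p := act (P (drop (f p).+1 w)) p.
have <- : size [seq c p | p <- s] = size s by rewrite size_map.
apply: uniq_leq_size.
  rewrite map_inj_in_uniq // => p q ps qs.
  wlog le : p q ps qs / (f p <= f q)%N.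
    by move=> H E; have [/H->//|/ltnW/H->] := leqP (f p) (f q).
  have [fp _ _] := fP p ps; have [fq _ _] := fP q qs.
  rewrite leq_eqVlt in le; case/orP: le => [/eqP E|lt] cE.
    by move: cE; rewrite /c E => /(act_inj actP).
  have e1 : eqv (act (P (drop (f p).+1 w)) y) (act (P (drop (f q).+1 w)) y).
    apply: (@eqv_trans _ (c p)); first by apply: eqv_act; apply: sy.
    by rewrite cE; apply/eqv_sym; apply: eqv_act; apply: sy.
  (* Equal crossing points at different times put two stages of the path in one class; cutting out
     the part between them contradicts minimality. *)
  pose w' := take (f p).+1 w ++ drop (f q).+1 w.
  have : (k <= size w')%N.
    apply: kmin; apply/asboolP; exists w'; split=> //.
      by move=> h; rewrite mem_cat => /orP[/mem_take/wS|/mem_drop/wS].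
    apply: eqv_trans wyz _; rewrite (P_drop (f p).+1) // /w' /P big_cat /=
      -!/(P _).
    by rewrite !(actM actP); apply: eqv_act.
  rewrite size_cat size_takel ?wk // size_drop wk leqNgt -ltn_subRL.
  by rewrite ltn_sub2l // (leq_trans _ fq).
move=> _ /mapP[p ps ->]; have [fp a1 a2] := fP p ps; apply: aF.
exists (nth 1 w (f p)); first by apply/wS/mem_nth; rewrite wk.
by rewrite a1 -(actM actP) -nth_drop' // (negbTE a2).
Qed.

End InvariantEquivalence.

(** * Normal subgroups and commutators in branch groups *)

Section BranchSubgroups.
Local Open Scope classical_set_scope.
Local Open Scope group_scope.
Context {G : groupType} {B : biset G} (X : basis B).
Hypotheses (fX : faithful X)
  (tX : forall v w : seq X, size v = size w -> exists g, word_act g v = w).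
Implicit Types (g h k p q : G) (u v w : seq X) (N K : set G).

Lemma rist_level_le m n : (m <= n)%N -> rist_level X n `<=` rist_level X m.
Proof.
move=> mn; apply: generated_min; first exact: generated_subgroup.
move=> g [v vn Lg]; apply: sub_generated; exists (take m v).
  by rewrite size_takel ?vn.
by apply: (rist_sub _ Lg); apply: prefix_take.
Qed.

(* If [k] in [N] moves [v], then for [p, q] in [rist v] the element
   [p * (k p^-1 k^-1)] of [N] has the same commutator with [q] as [p], up to
   conjugation. *)
Lemma normal_commutator N : is_subgroup N ->
  (forall g k, N k -> N (g^-1 * k * g)) -> (exists2 k, N k & k != 1) ->
  exists m, forall n, (m <= n)%N -> commutator_subgroup (rist_level X n) `<=` N.
Proof.
move=> NG NJ [k Nk k1]; have [N1 NM NV] := NG.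
have [v kv] : exists v : seq X, word_act k v != v.
  apply: contrapT => no; move/eqP: k1; apply; apply: fX => w.
  by apply: contrapT => /eqP kw; apply: no; exists w.
have com p q : rist v p -> rist v q -> N [~ p, q].
  move=> Lp Lq; have [_ _ LV] := rist_subgroup v.
  pose c := k * p^-1 * k^-1.
  have Qc : point_kernel v c.
    apply: (rist_point_kernel fX _ _ (ristJ (LV _ Lp))).
      by rewrite size_word_act.
    by rewrite eq_sym.
  have Npc : N (p * c).
    have -> : p * c = (p^-1^-1 * k * p^-1) * k^-1 by rewrite /c invgK !mulgA.
    by apply: NM; [apply: NJ|apply: NV].
  clearbody c.
  have Nc : N (c^-1 * [~ p, q] * c).
    have -> : c^-1 * [~ p, q] * c = (p * c)^-1 * (q^-1 * (p * c) * q).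
      by rewrite (invgM p c) /commg /conjg -!mulgA (rist_point_kernelC fX Lq
        Qc).
    by apply: NM; [apply: NV|apply: NJ].
  move: [~ p, q] Nc => x Nc; have := NJ c^-1 _ Nc.
  by rewrite invgK !mulgA mulgV mul1g mulgK.
exists (size v) => n vn; apply: (@subset_trans _ (commutator_subgroup
  (rist_level X (size v)))).
  apply: generated_min; first exact: generated_subgroup.
  move=> _ [g [h [Hg Hh ->]]]; apply: sub_generated; exists g, h.
  by split=> //; apply: (rist_level_le vn).
apply: generated_min => // _ [g [h [Hg Hh ->]]].
apply: (commg_congr_generated NG NJ _ Hg Hh) => p q [w wv Lp] [w' w'v Lq].
have [ww'|ww'] := eqVneq w w'; last first.
  have -> : [~ p, q] = 1; last exact: N1.
  apply/eqP/commgP; apply: (rist_point_kernelC fX Lp).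
  by apply: (rist_point_kernel fX _ ww' Lq); rewrite wv.
(* Transitivity on the level conjugates the pair into [rist v], where [com] applies. *)
rewrite -ww' in Lq; have [g0 g0w] := tX wv.
have Lp' := ristJ (g := g0) Lp; have Lq' := ristJ (g := g0) Lq.
rewrite g0w in Lp' Lq'; have := NJ g0 _ (com _ _ Lp' Lq').
have -> // : g0^-1 * [~ g0 * p * g0^-1, g0 * q * g0^-1] * g0 = [~ p, q].
have conjE x : g0 * x * g0^-1 = x ^ g0^-1 by rewrite conjgE invgK mulgA.
rewrite !conjE -conjRg; move: [~ p, q] => x.
by rewrite conjgE invgK !mulgA mulVg mul1g mulgVK.
Qed.

(** Take [k] moving [v] and [p] supported below [v]: if they commuted, [p] would also be supported
    below the image of [v], hence trivial. *)
Lemma noncommuting_pair K : is_subgroup K ->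
  fin_sep [set: G] K -> (forall v : seq X, ~ finite_set (rist v)) ->
  exists k k', [/\ K k, K k' & [~ k, k'] != 1].
Proof.
move=> KG sK inf.
have [k [_ Kk k1]] := fin_sep_infinite sK (inf [::]) (rist_subgroup _).
have [v kv] : exists v : seq X, word_act k v != v.
  apply: contrapT => no; move/eqP: k1; apply; apply: fX => w.
  by apply: contrapT => /eqP kw; apply: no; exists w.
have [p [Lp Kp p1]] := fin_sep_infinite sK (inf v) (rist_subgroup _).
exists k, p; split=> //; apply: contra p1 => /commgP kp.
apply/eqP; apply: (rist_point_kernelI fX Lp).
have -> : p = k * p * k^-1 by rewrite kp mulgK.
apply: (rist_point_kernel fX _ _ (ristJ Lp)); first by rewrite size_word_act.
by rewrite eq_sym.
Qed.

End BranchSubgroups.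

(** * Active vertices of a transitive action *)

Section BranchAction.
Local Open Scope classical_set_scope.
Local Open Scope group_scope.
Context {G : groupType} {B : biset G} (X : basis B).
Context {Y : choiceType} (act : G -> Y -> Y).
Hypothesis actP : is_action act.
Variable S : seq G.
Hypotheses (SG : fin_gen [set: G] S) (fX : faithful X) (bX : branch X).
Implicit Types (g h l q k : G) (u v w : seq X) (x y z p : Y) (a : pred Y).

Lemma fin_sep_rist_level n : fin_sep [set: G] (rist_level X n).
Proof. by apply: finite_index_sep; [apply: generated_subgroup|apply: bX.2]. Qed.

Lemma fin_sep_rist_prod v : fin_sep [set: G] (rist_prod v).
Proof.
have [T [c cH]] := fin_sep_rist_level (size v).
exists T, c => g h Kg Kh /(cH g h Kg Kh).
exact: (rist_level_prod fX).
Qed.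

Lemma fin_gen_rist v : exists U, fin_gen (rist v) U.
Proof.
have [V VD] := schreier SG (rist_prod_subgroup fX v) (fin_sep_rist_prod v).
have [Q1 _ _] := point_kernel_subgroup v.
apply: (fin_gen_factor (rist_subgroup v) (point_kernel_subgroup v)
  (@rist_point_kernelC _ _ _ fX v) (@rist_point_kernelI _ _ _ fX v) _ _ VD).
  by move=> l Ll; exists l => //; exists 1; rewrite ?mulg1.
by [].
Qed.

Lemma fin_gen_point_kernel v : exists U, fin_gen (point_kernel v) U.
Proof.
have [V VD] := schreier SG (rist_prod_subgroup fX v) (fin_sep_rist_prod v).
have [L1 _ _] := rist_subgroup v.
apply: (fin_gen_factor (point_kernel_subgroup v) (rist_subgroup v) _ _ _ _ VD).
- by move=> q l Qq Ll; rewrite (rist_point_kernelC fX Ll).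
- by move=> g Qg Lg; apply: (rist_point_kernelI fX Lg).
- by move=> q Qq; exists 1 => //; exists q; rewrite ?mul1g.
- move=> _ [l Ll [q Qq ->]]; exists q => //; exists l => //.
  by rewrite (rist_point_kernelC fX Ll).
Qed.

Definition active v y := ~ finite_set (act_orbit act (rist v) y).

Lemma active_act g v y : active v y -> active (word_act g v) (act g y).
Proof.
move=> av fin; apply: av; apply/(@finite_translate _ _ _ actP g^-1).
apply: sub_finite_set fin => z [l Ll E]; exists (g * l * g^-1);
  first exact: ristJ.
by rewrite -!(actM actP) mulgVK (actM actP) E (actVK actP).
Qed.

Hypothesis tr : forall y z : Y, exists g, act g y = z.

Fixpoint product_orbit (s : seq (seq X)) y : set Y :=
  if s is v :: s' then \bigcup_(p in product_orbit s' y) act_orbit act (rist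
    v) p
  else [set y].

Lemma product_orbit_closed n (s : seq (seq X)) y v g p :
  uniq s -> {in s, forall w, size w = n} -> v \in s -> rist v g ->
  product_orbit s y p -> product_orbit s y (act g p).
Proof.
elim: s v g p => //= w s IH v g p /andP[ws us] sn vs Lg.
rewrite inE in vs; case/orP: vs => [/eqP vw|vs] [p' op' opp'].
  exists p' => //; apply: (act_orbit_sub actP (rist_subgroup w) opp').
  by exists g; rewrite -?vw.
have [l Ll <-] := opp'; exists (act g p').
  by apply: (IH v) => // u us'; apply: sn; rewrite inE us' orbT.
exists l => //; rewrite -!(actM actP) (rist_point_kernelC fX Ll) //.
apply: (rist_point_kernel fX _ _ Lg);
  rewrite ?(sn w) ?(sn v) ?inE ?eqxx ?vs ?orbT //.
by apply: contraNneq ws => ->.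
Qed.

(** If no vertex of level [n] is active at [y], transitivity makes all orbits of the [rist v] on
    that level finite; then so is the orbit of [y] under [RiSt(n)], and finite index makes [Y]
    finite. *)
Lemma active_exists n y : ~ finite_set [set: Y] -> exists2 v,
  size v = n & active v y.
Proof.
move=> infY; apply: contrapT => none; apply: infY.
have fin v z : size v = n -> finite_set (act_orbit act (rist v) z).
  move=> sv; apply: contrapT => av; apply: none; have [g gz] := tr z y.
  exists (word_act g v); first by rewrite size_word_act.
  by rewrite -gz; apply: active_act.
pose s : seq (seq X) := [seq tval t | t <- enum {: n.-tuple X}].
have us : uniq s by rewrite map_inj_uniq ?enum_uniq //; apply: val_inj.
have sn : {in s, forall w, size w = n} by move=> _ /mapP[t _ ->];
  rewrite size_tuple.
have sin v : size v = n -> v \in s.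
  move=> /eqP vn; apply/mapP; exists (Tuple vn) => //; exact: mem_enum.
have finO : finite_set (product_orbit s y).
  elim: (s) sn => [_|v s' IH sn] /=; first exact: finite_set1.
  apply: bigcup_finite; first by apply: IH => w ws; apply: sn;
    rewrite inE ws orbT.
  by move=> p _; apply: fin; apply: sn; rewrite inE eqxx.
have oy : product_orbit s y y.
  elim: (s) => //= v s' IH; exists y => //; apply: act_orbit_self => //.
  exact: rist_subgroup.
(* Invariance under the inverse is carried along so that the condition defines a subgroup. *)
have stab : rist_level X n `<=` [set g | forall p, product_orbit s y p ->
    product_orbit s y (act g p) /\ product_orbit s y (act g^-1 p)].
  apply: generated_min.
    split=> [p op|g h Hg Hh p op|g Hg p op].
    - by rewrite invg1 !(act1 actP).
    - rewrite invgM !(actM actP); split; first by apply: (Hg _ _).1;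
      apply: (Hh _ _).1.
      by apply: (Hh _ _).2; apply: (Hg _ _).2.
    - by rewrite invgK; have [] := Hg p op.
  move=> g [v vn Lg] p op; have [_ _ LV] := rist_subgroup v.
  by split; apply: (product_orbit_closed us sn (sin v vn)) => //; apply: LV.
have [F _ FP] := fin_sep_reps (fin_sep_rist_level n).
apply: (@sub_finite_set _ _ [set act f p | f in [set` F] & p in product_orbit
  s y]).
  move=> z _; have [g gz] := tr y z; have [f fF Hf] := FP g I.
  exists f => //; exists (act (f^-1 * g) y); first by case: (stab _ Hf y oy).
  by rewrite -(actM actP) mulVKg.
by apply: finite_image2 => //; apply: finite_seq.
Qed.

Lemma active_infinite v y a : almost_invariant act a -> active v y ->
  ~ finite_set [set z | a z] -> ~ finite_set [set z | act_orbit act (rist v) y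
    z /\ a z].
Proof.
move=> aA av inf fin; apply: inf; have [U LU] := fin_gen_rist v.
exact: (finite_halfspace actP (rist_subgroup v) (point_kernel_subgroup v) LU
  (@rist_point_kernelC _ _ _ fX v) (fin_sep_rist_prod v) (tr y) aA av fin).
Qed.

Section NontrivialSet.
Variable a : pred Y.
Hypotheses (aA : almost_invariant act a) (inf_a : ~ finite_set [set z | a z])
  (inf_na : ~ finite_set [set z | ~~ a z]).

Lemma infinite_space : ~ finite_set [set: Y].
Proof. by move=> fY; apply: inf_a; apply: sub_finite_set fY. Qed.

Lemma active_point_kernel v y q :
  active v y -> point_kernel v q -> active v (act q y).
Proof. by move=> av [qv _]; have := active_act (g := q) av; rewrite qv. Qed.

Lemma active_meets_boundary v U y : fin_gen (rist v) U -> active v y ->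
  exists p, boundary act U a p /\ act_orbit act (rist v) y p.
Proof.
move=> LU av; apply: contrapT => no.
have [z1 [o1 a1]] := infinite_setN0 (active_infinite aA av inf_a).
have [z2 [o2 /= a2]] := infinite_setN0
  (active_infinite (almost_invariantN aA) av inf_na).
have C := act_orbit_const (a := a) actP LU (rist_subgroup v) (y := y).
have {}C := C (fun p op bp => no (ex_intro _ p (conj bp op))).
by move: a2; rewrite (C _ o2) -(C _ o1) a1.
Qed.

Let kernel : set G := [set g | forall z, act g z = z].

Let kernel_subgroup : is_subgroup kernel.
Proof.
split=> [z|g h Hg Hh z|g Hg z]; first by rewrite (act1 actP).
  by rewrite (actM actP) Hh Hg.
by rewrite -{1}(Hg z) (actK actP).
Qed.

Let kernelJ g k : kernel k -> kernel (g^-1 * k * g).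
Proof. by move=> Hk z; rewrite !(actM actP) Hk (actK actP). Qed.

Lemma rist_infinite v : ~ finite_set (rist v).
Proof.
have [y _] := infinite_setN0 infinite_space.
have [w wv aw] := active_exists (size v) y infinite_space.
have [g gw] := bX.1 w v wv.
move=> fin; have := active_act (g := g) aw; rewrite gw; apply.
by apply: sub_finite_set (finite_image (fun l => act l (act g y)) fin).
Qed.

Lemma infinite_point_kernel_orbit v y : active v y ->
  ~ finite_set (act_orbit act (point_kernel v) y) ->
  exists m, forall n, (m <= n)%N ->
    forall g, commutator_subgroup (rist_level X n) g -> forall z, act g z = z.
Proof.
move=> av infQ; have [U LU] := fin_gen_rist v.
have [B0 [B0G sB comB]] : exists B : set G, [/\ is_subgroup B,
    fin_sep [set: G] B & forall g h, B g -> B h -> act [~ g, h] y = y].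
  apply: (two_ended actP (rist_subgroup v) (point_kernel_subgroup v) LU
    (@rist_point_kernelC _ _ _ fX v) (fin_sep_rist_prod v) aA _ _ _ infQ).
  - by move=> q Qq; apply: active_meets_boundary LU (active_point_kernel av Qq).
  - exact: active_infinite.
  - exact: (active_infinite (almost_invariantN aA)).
(* Commutators of the normal core fix not only [y] but, by transitivity, every point. *)
have sK := finite_index_core B0G sB; set K := [set k | _] in sK.
have KG : is_subgroup K.
  have [B1 BM BV] := B0G; split=> [g|k k' Hk Hk' g|k Hk g].
  - by rewrite mulg1 mulVg.
  - have -> : g^-1 * (k * k') * g = (g^-1 * k * g) * (g^-1 * k' * g).
      by rewrite !mulgA mulgK.
    exact: BM.
  - by have := BV _ (Hk g); rewrite !invgM invgK mulgA.
have comK k k' : K k -> K k' -> kernel [~ k, k'].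
  move=> Kk Kk' z; have [g gz] := tr y z; rewrite -gz.
  have := comB _ _ (Kk g) (Kk' g).
  have conjE (x : G) : g^-1 * x * g = x ^ g by rewrite conjgE mulgA.
  rewrite !conjE -conjRg conjgE -mulgA !(actM actP).
  by move=> /(congr1 (act g)); rewrite (actVK actP).
have [k [k' [Kk Kk' kk']]] := noncommuting_pair fX KG sK rist_infinite.
apply: (normal_commutator fX bX.1 kernel_subgroup kernelJ).
by exists [~ k, k'] => //; apply: comK.
Qed.

End NontrivialSet.
End BranchAction.

(** * Counting by finite covers *)

Lemma bounded_cover (T : eqType) (A : set T) K :
  (forall s : seq T, uniq s -> {in s, forall x, A x} -> (size s <= K)%N) ->
  exists2 s : seq T, (size s <= K)%N & forall x, A x <-> x \in s.
Proof.
move=> bound; have ex : exists k, `[< exists s : seq T,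
    [/\ size s = k, uniq s & {in s, forall x, A x}] >].
  by exists 0; apply/asboolP; exists [::].
have ub k : `[< exists s : seq T, [/\ size s = k, uniq s & {in s, forall x,
  A x}] >] ->
    (k <= K)%N.
  by move=> /asboolP[s [<- us As]]; apply: bound.
case: (ex_maxnP ex ub) => k /asboolP[s [sk us As]] kmax.
exists s => [|x]; first exact: bound.
split=> [Ax|/As//]; apply: contraT => xs.
suff : (k.+1 <= k)%N by rewrite ltnn.
apply: kmax; apply/asboolP; exists (x :: s); split=> /=; rewrite ?sk ?xs //.
by move=> z; rewrite inE => /orP[/eqP->|/As].
Qed.

Lemma cover_by_code (T C : eqType) (D : T -> Prop) (R : C -> T -> Prop)
    (L : seq C) K :
  (forall x, D x -> exists2 c, c \in L & R c x) ->
  (forall c x, D x -> R c x -> exists2 s : seq T, (size s <= K)%N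
     & forall y, D y -> R c y -> y \in s) ->
  exists2 s : seq T, (size s <= size L * K)%N & forall x, D x -> x \in s.
Proof.
move=> DL RK; have [s sK sP] : exists2 s : seq T, (size s <= size L * K)%N
    & forall c x, c \in L -> D x -> R c x -> x \in s.
  elim: (L) => [|c L' [s sK sP]]; first by exists [::].
  have [t tK tP] : exists2 t : seq T, (size t <= K)%N
      & forall y, D y -> R c y -> y \in t.
    have [[x Dx Rx]|no] := pselect (exists2 x, D x & R c x); first exact: RK Rx.
    by exists [::] => // y Dy Ry; case: no; exists y.
  exists (t ++ s); first by rewrite size_cat mulSn leq_add.
  move=> d x; rewrite inE mem_cat => /orP[/eqP->|dL] Dx Rx.
    by rewrite tP.
  by rewrite (sP d) ?orbT.
by exists s => // x Dx; have [c cL Rc] := DL x Dx; apply: sP Rc.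
Qed.

Lemma cover_union (I T : eqType) (r : seq I) (D : I -> T -> Prop) (k :
  I -> nat) :
  (forall i, i \in r -> exists2 s : seq T, (size s <= k i)%N
     & forall x, D i x -> x \in s) ->
  exists2 s : seq T, (size s <= \sum_(i <- r) k i)%N
     & forall i x, i \in r -> D i x -> x \in s.
Proof.
elim: r => [|i r IH] H; first by exists [::]; rewrite ?big_nil.
have [s sk sP] := H i (mem_head _ _).
have [|t tk tP] := IH; first by move=> j jr; apply: H; rewrite inE jr orbT.
exists (s ++ t); first by rewrite size_cat big_cons leq_add.
move=> j x; rewrite inE mem_cat => /orP[/eqP->|jr] Dx; first by rewrite sP.
by rewrite (tP j) ?orbT.
Qed.

(** * Finite kernel orbits and the equivalence relation they define *)

Section FiniteKernelOrbits.
Local Open Scope classical_set_scope.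
Local Open Scope group_scope.
Context {G : groupType} {B : biset G} (X : basis B).
Context {Y : choiceType} (act : G -> Y -> Y).
Hypothesis actP : is_action act.
Variable S : seq G.
Hypotheses (SG : fin_gen [set: G] S) (fX : faithful X) (bX : branch X).
Hypothesis tr : forall y z : Y, exists g, act g y = z.
Implicit Types (g h l q k : G) (u v w : seq X) (x y z p : Y).

Local Notation active := (@active G B X Y act).
Hypothesis finQ : forall v y, active v y ->
  finite_set (act_orbit act (point_kernel v) y).
Hypothesis infY : ~ finite_set [set: Y].

Let active_ex n y : exists2 v, size v = n & active v y.
Proof. exact: active_exists. Qed.

Let act_active g v y : active v y -> active (word_act g v) (act g y).
Proof. exact: active_act. Qed.

(** If [v] is not a prefix of [w], then [rist w] lies in [point_kernel v], whose orbit at [y] is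
    finite. *)
Lemma active_prefix v w y : active v y -> active w y ->
  (size v <= size w)%N -> prefix v w.
Proof.
move=> av aw vw; rewrite prefixE; apply: contraT => ne.
case: aw; apply: sub_finite_set (finQ av) => _ [l Ll <-]; exists l => //.
apply: (rist_point_kernel fX (v := take (size v) w)).
- by rewrite size_takel.
- by rewrite eq_sym.
- by apply: (rist_sub _ Ll); apply: prefix_take.
Qed.

(** The active vertex of a given level is unique, so the existential hides no choice. *)
Definition kernel_eqv n y z :=
  exists v, [/\ size v = n, active v y & act_orbit act (point_kernel v) y z].

Lemma kernel_eqv_active n y z v : kernel_eqv n y z -> size v = n ->
  active v y -> active v z /\ act_orbit act (point_kernel v) y z.
Proof.
move=> [w [wn aw oz]] vn av.
have -> : v = w.
  have := active_prefix av aw; rewrite vn wn => /(_ (leqnn _)).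
  by move=> p; apply: (@prefix_size_eq _ _ _ v w [::]);
    rewrite ?vn ?wn ?cats0 //;
     have := active_prefix aw av; rewrite vn wn => /(_ (leqnn _)).
by split=> //; case: oz => q Qq <-; apply: active_point_kernel.
Qed.

Lemma kernel_eqv_refl n y : kernel_eqv n y y.
Proof.
have [v vn av] := active_ex n y; exists v; split=> //.
by apply: act_orbit_self => //; apply: point_kernel_subgroup.
Qed.

Lemma kernel_eqv_sym n y z : kernel_eqv n y z -> kernel_eqv n z y.
Proof.
move=> yz; have [v [vn av _]] := yz; have [az oz] := kernel_eqv_active yz vn av.
by exists v; split=> //; apply: act_orbit_sym oz => //;
  apply: point_kernel_subgroup.
Qed.

Lemma kernel_eqv_trans n x y z :
  kernel_eqv n x y -> kernel_eqv n y z -> kernel_eqv n x z.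
Proof.
move=> xy yz; have [v [vn av _]] := xy;
  have [ay oy] := kernel_eqv_active xy vn av.
have [_ oz] := kernel_eqv_active yz vn ay; exists v; split=> //.
by apply: (act_orbit_sub actP (point_kernel_subgroup v) oy).
Qed.

Lemma kernel_eqv_act n g y z :
  kernel_eqv n y z -> kernel_eqv n (act g y) (act g z).
Proof.
move=> [v [vn av [q Qq <-]]]; exists (word_act g v); split.
- by rewrite size_word_act.
- exact: act_active.
- exists (g * q * g^-1); first exact: point_kernelJ.
  by rewrite -!(actM actP) mulgVK.
Qed.

Lemma kernel_eqv_mono m n y z :
  (m <= n)%N -> kernel_eqv m y z -> kernel_eqv n y z.
Proof.
move=> mn [v [vm av [q Qq <-]]]; have [w wn aw] := active_ex n y.
exists w; split=> //; exists q => //.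
have vw : prefix v w by apply: (active_prefix av aw); rewrite vm wn.
exact: (point_kernel_sub vw Qq).
Qed.

Lemma kernel_eqv_finite n y : finite_set [set z | kernel_eqv n y z].
Proof.
have [v vn av] := active_ex n y; apply: sub_finite_set (finQ av) => z yz.
by have [] := kernel_eqv_active yz vn av.
Qed.

(** A class meeting both sides is a [Q]-orbit crossing the boundary for generators of [Q]. Level [n]
    has finitely many vertices, each boundary is finite, and so is each class. *)
Lemma impure_finite (a : pred Y) n : almost_invariant act a ->
  finite_set [set y | a y /\ exists2 z, kernel_eqv n y z & ~~ a z].
Proof.
move=> aA; have [V VP] : {V : seq X -> seq G & forall v,
  fin_gen (point_kernel v) (V v)}.
  apply: (@choice _ _ (fun v V => fin_gen (point_kernel v) V)) => v.
  exact: (fin_gen_point_kernel SG).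
apply: (@sub_finite_set _ _ (\bigcup_(p in \bigcup_(t in [set: n.-tuple X])
    boundary act (V (tval t)) a) [set z | kernel_eqv n p z])).
  move=> y [ay [z yz az]]; have [v [vn av [q Qq qz]]] := yz.
  have [[p [bp op]]|no] := pselect (exists p, boundary act (V v) a p /\
      act_orbit act (point_kernel v) y p).
    exists p; last by apply: kernel_eqv_sym; exists v.
    by move/eqP: vn => vn; exists (Tuple vn).
  have := act_orbit_const (a := a) actP (VP v) (point_kernel_subgroup v) (y :=
    y).
  move=> /(_ (fun p op bp => no (ex_intro _ p (conj bp op))) z) az'.
  by move: az; rewrite az' ?ay //; exists q.
apply: bigcup_finite => [|p _]; last exact: kernel_eqv_finite.
apply: bigcup_finite => [|t _]; first exact: finite_finset.
exact: finite_boundary.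
Qed.

Lemma pure_exists (a : pred Y) n : almost_invariant act a ->
  ~ finite_set [set y | a y] -> exists y, forall z, kernel_eqv n y z -> a z.
Proof.
move=> aA inf; apply: contrapT => no; apply: inf.
apply: sub_finite_set (impure_finite n aA) => y ay; split=> //.
apply: contrapT => no'; apply: no; exists y => z yz.
by apply: contraT => az; case: no'; exists z.
Qed.

Section Saturation.
Variable a : pred Y.
Hypotheses (aA : almost_invariant act a) (inf_a : ~ finite_set [set z | a z])
  (inf_na : ~ finite_set [set z | ~~ a z]).

(** Some class lies inside [a] and some class outside, so the boundary for [S] bounds the first one,
    uniformly in [n]; transitivity carries any class onto it. *)
Lemma kernel_class_bound : exists K, forall n y (s : seq Y), uniq s ->
  {in s, forall z, kernel_eqv n y z} -> (size s <= K)%N.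
Proof.
have /finite_seqP[F FE] := finite_boundary S aA.
exists (size F) => n y s us sy.
have [yp ypP] := pure_exists n aA inf_a.
have [ym ymP] := pure_exists n (almost_invariantN aA) inf_na.
have [g gy] := tr y yp.
have <- : size [seq act g z | z <- s] = size s by rewrite size_map.
apply: (class_size_bound actP SG tr (@kernel_eqv_refl n) (@kernel_eqv_sym n)
  (@kernel_eqv_trans n) (@kernel_eqv_act n) _ ypP ymP).
- by move=> p; rewrite FE.
- by rewrite map_inj_uniq // => z z'; apply: (act_inj actP).
- by move=> _ /mapP[z /sy yz ->]; rewrite -gy; apply: kernel_eqv_act.
Qed.

Definition eqv y z := exists n, kernel_eqv n y z.

Lemma eqv_classes : exists K, forall y, exists2 s : seq Y, (size s <= K)%N
  & forall z, eqv y z <-> z \in s.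
Proof.
have [K bound] := kernel_class_bound; exists K => y;
  apply: bounded_cover => s us sy.
have [n nP] : exists n, {in s, forall z m, (n <= m)%N -> kernel_eqv m y z}.
  apply: uniform_bound => z /sy[n yz]; exists n => m nm.
  exact: kernel_eqv_mono yz.
by apply: (bound n y) => // z zs; apply: nP.
Qed.

(** Increasing classes with finite union stabilize at one point [y0], and by invariance at the same
    level everywhere. *)
Lemma eqv_stable : exists n, forall y z, eqv y z -> kernel_eqv n y z.
Proof.
have [y0 _] := infinite_setN0 infY.
have [K HK] := eqv_classes; have [s _ sP] := HK y0.
have [n nP] : exists n, {in s, forall z m, (n <= m)%N -> kernel_eqv m y0 z}.
  apply: uniform_bound => z /sP[n yz]; exists n => m nm.
  exact: kernel_eqv_mono yz.
exists n => y z [m yz]; have [g gy] := tr y y0.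
have : kernel_eqv n y0 (act g z).
  by apply: nP => //; apply/sP; exists m; rewrite -gy; apply: kernel_eqv_act.
move=> /(kernel_eqv_act g^-1).
by rewrite -gy !(actK actP).
Qed.

(** Shrinks [a] to the classes that it contains entirely; only impure points are lost, and these are
    finitely many. *)
Definition saturation : pred Y := fun y => `[< forall z, eqv y z -> a z >].

Lemma saturation_eqv y z : eqv y z -> saturation y = saturation z.
Proof.
have half y' z' : eqv y' z' -> saturation y' -> saturation z'.
  move=> [n yz] /asboolP H; apply/asboolP => p [m zp]; apply: H.
  exists (maxn n m); apply: (kernel_eqv_trans (y := z')).
    exact: kernel_eqv_mono (leq_maxl _ _) yz.
  exact: kernel_eqv_mono (leq_maxr _ _) zp.
move=> yz; apply/idP/idP; apply: half => //.
by have [n /kernel_eqv_sym H] := yz; exists n.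
Qed.

Lemma saturation_finite : finite_set [set y | a y != saturation y].
Proof.
have [n nP] := eqv_stable; apply: sub_finite_set (impure_finite n aA) =>
  y /= ne.
have [sy|nsy] := boolP (saturation y).
  move/asboolP: (sy) => /(_ y) ay; move: ne; rewrite sy ay //.
  by exists 0; apply: kernel_eqv_refl.
have ay : a y by move: ne; rewrite (negbTE nsy); case: (a y).
split=> //; apply: contrapT => no; move/negP: nsy; apply; apply/asboolP => z.
by move=> /nP yz; apply: contraT => az; case: no; exists z.
Qed.

Lemma saturation_almost_invariant : almost_invariant act saturation.
Proof.
move=> g; apply: (@sub_finite_set _ _ ([set y | a y != saturation y] `|`
  [set y | a y != a (act g y)] `|` [set y | a (act g y) != saturation (act g
    y)])).
  move=> y /= ne; have [e1|] := eqVneq (a y) (saturation y); last by left; left.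
  have [e2|] := eqVneq (a y) (a (act g y)); last by left; right.
  by right; rewrite -e2 e1.
rewrite !finite_setU; split; first split; [exact: saturation_finite|exact: aA|].
apply/(@finite_translate _ _ _ actP g [set y | a y != saturation y]).
exact: saturation_finite.
Qed.

Hypotheses (sX : self_replicating X) (cX : contracting X).

(* The points where a lift of [t] crosses the boundary of the saturation are
   determined, up to their class,
     by the crossing point and the section there. *)
Lemma generator_cover : exists c, forall v t, t \in S -> exists g,
  [/\ word_act g v = v, section g v = t & exists2 s : seq Y, (size s <= c)%N
    & forall y, active v y -> saturation y != saturation (act g y) -> y \in s].
Proof.
have [M MP] := bounded_lift sX SG cX.
have /finite_seqP[F FE] := finite_boundary S saturation_almost_invariant.
have [K KP] := eqv_classes.
(* Neither [F] nor [M] depends on [v]: this is where the uniformity of the bound comes from. *)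
exists (size [seq (p, m) | p <- F, m <- M] * K)%N => v t tS.
have [w [wS wv wt wM]] := MP v t tS; pose P (w : seq G) : G := \prod_(h <- w) h.
exists (P w); split=> //.
pose R (c : Y * G) y := exists g, [/\ active v y,
  act g y = c.1 & section g v = c.2].
pose D y := active v y /\ saturation y != saturation (act (P w) y).
suff [DL RK] : (forall y, D y -> exists2 c, c \in [seq (p, m) | p <- F,
  m <- M] & R c y)
    /\ (forall c y, D y -> R c y -> exists2 s : seq Y, (size s <= K)%N
          & forall z, D z -> R c z -> z \in s).
  have [s sK sP] := cover_by_code DL RK; exists s => // y av ne.
  exact: sP.
split; last first.
- move=> c y _ [g [av gy gc]]; have [s sK sP] := KP y;
  exists s => // z _ [h [az hz hc]].
  apply/sP; exists (size v); exists v; split=> //.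
  (* Both images of [v] are active at the same point [c.1] and have equal length, hence coincide. *)
  have gh : word_act g v = word_act h v.
    have ag := act_active (g := g) av; have ah := act_active (g := h) az.
    rewrite gy in ag; rewrite hz in ah; have := active_prefix ag ah.
    rewrite !size_word_act => /(_ (leqnn _)) pre.
    by apply/esym/(@prefix_size_eq _ _ _ _ _ [::]);
      rewrite ?cats0 ?size_word_act.
  exists (h^-1 * g); first by apply: same_section_point_kernel;
    rewrite ?gh // hc gc.
  by rewrite (actM actP) gy -hz (actK actP).
- move=> y [av ne].
  have [i bi] := word_boundary actP wS ne.
  exists (act (P (drop i w)) y, section (P (drop i w)) v).
    apply/flatten_mapP; exists (act (P (drop i w)) y).
      by have : [set` F] (act (P (drop i w)) y) by rewrite -FE.
    by apply/mapP; exists (section (P (drop i w)) v) => //; apply: wM.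
  by exists (P (drop i w)).
Qed.

(** Crossings add up along a word: those of [h * g] are among those of [g] and the [g]-preimages of
    those of [h]. *)
Lemma word_cover : exists c, forall v (ts : seq G),
  {subset ts <= S} -> exists g,
  [/\ word_act g v = v, section g v = \prod_(t <- ts) t
    & exists2 s : seq Y, (size s <= c * size ts)%N
    & forall y, active v y -> saturation y != saturation (act g y) -> y \in s].
Proof.
have [c cP] := generator_cover; exists c => v; elim=> [|t ts IH] tS.
  exists 1; split; rewrite ?word_act1 ?section1 ?big_nil //.
  by exists [::] => // y _; rewrite (act1 actP) eqxx.
have [|g [gv gs [s sK sP]]] := IH; first by move=> h ht; apply: tS;
  rewrite inE ht orbT.
have [|h [hv hs [r rK rP]]] := cP v t; first by apply: tS; rewrite inE eqxx.
exists (h * g); split; first by rewrite word_actM gv.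
  by rewrite sectionM gv hs gs big_cons.
exists ([seq act g^-1 y | y <- r] ++ s).
  by rewrite size_cat size_map mulnS leq_add.
move=> y av; have [e1|ne _] := eqVneq (saturation y) (saturation (act g y));
  last first.
  by rewrite mem_cat sP ?orbT.
rewrite e1 (actM actP) => ne; rewrite mem_cat; apply/orP; left; apply/mapP.
exists (act g y); last by rewrite (actK actP).
by apply: rP => //; rewrite -gv; apply: act_active.
Qed.

(** An arbitrary [g] and the lift of its section agree up to [point_kernel v], so they send [y] to
    equivalent points, which the saturation does not distinguish. *)
Lemma section_cover : exists c, forall v g (ts : seq G), {subset ts <= S} ->
  word_act g v = v -> section g v = \prod_(t <- ts) t ->
  exists2 s : seq Y, (size s <= c * size ts)%N
    & forall y, active v y -> saturation y != saturation (act g y) -> y \in s.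
Proof.
have [c cP] := word_cover; exists c => v g ts tS gv gs.
have [h [hv hs [s sK sP]]] := cP v ts tS; exists s => // y av ne.
apply: sP => //; suff <- : saturation (act g y) = saturation (act h y) by [].
have -> : act h y = act g (act (g^-1 * h) y) by rewrite -(actM actP) mulVKg.
apply: saturation_eqv; exists (size v); apply: kernel_eqv_act.
exists v; split=> //; exists (g^-1 * h) => //.
by apply: same_section_point_kernel; rewrite ?gv ?hv ?gs ?hs.
Qed.

End Saturation.
End FiniteKernelOrbits.

(** * Word length and generating lists *)

Section WordLength.
Local Open Scope classical_set_scope.
Local Open Scope group_scope.
Context {G : groupType}.
Implicit Types (g : G) (N : set G) (T : seq G).

Lemma word_lengthP N g : generated N = [set: G] ->
  is_word_of_length N g (word_length N g).
Proof.
move=> NG; rewrite /word_length; case: pselect => [e|[]].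
  by case: ex_minnP => k /asboolP.
have [|s sN gE] := @generated_word _ N g; first by rewrite NG.
by exists (size s); apply/asboolP; exists s.
Qed.

Lemma word_length1 N : word_length N 1 = 0.
Proof.
rewrite /word_length; case: pselect => // e; case: ex_minnP => k _ kmin.
apply/eqP; rewrite -leqn0; apply: kmin; apply/asboolP.
by exists [::]; rewrite big_nil.
Qed.

Lemma word_length_gt0 N g : generated N = [set: G] -> g != 1 ->
  (0 < word_length N g)%N.
Proof.
move=> NG; apply: contraNT; rewrite -eqn0Ngt => /eqP l0.
have [s [s0 _ ->]] := word_lengthP g NG; rewrite l0 in s0.
by rewrite (size0nil s0) big_nil.
Qed.

Lemma fin_gen_extend T : finitely_generated G ->
  exists2 S, fin_gen [set: G] S & {subset T <= S}.
Proof.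
move=> [S0 /finite_seqP[s ->] sG]; pose S1 := T ++ s.
have TS : {subset S1 <= S1 ++ [seq g^-1 | g <- S1]}.
  by move=> g gT; rewrite mem_cat gT.
have VS g : g \in S1 -> g^-1 \in S1 ++ [seq g^-1 | g <- S1].
  by move=> gT; rewrite mem_cat (map_f _ gT) orbT.
exists (S1 ++ [seq g^-1 | g <- S1]); last first.
  by move=> g gT; apply: TS; rewrite mem_cat gT.
split=> // [u|l _].
  rewrite mem_cat => /orP[/VS//|/(@mapP G G)[g gS ->]].
  by rewrite invgK; apply: TS.
have [|w wS ->] := @generated_word _ [set` s] l; first by rewrite sG.
exists w => // h /wS[] hs.
  by apply: TS; rewrite mem_cat orbC; apply/orP; left.
by rewrite -[h]invgK; apply: VS; rewrite mem_cat orbC; apply/orP; left.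
Qed.

End WordLength.

(** * The linear bound *)

Section Bound.
Local Open Scope classical_set_scope.
Local Open Scope group_scope.
Context {G : groupType} {B : biset G} (X : basis B) (N : set G).
Hypotheses (fG : finitely_generated G) (fX : faithful X) (cX : contracting X)
  (sX : self_replicating X) (bX : branch X) (cN : contracting_set X N).
Implicit Types (g : G).

Definition section_length n g : nat :=
  \sum_(v : n.-tuple X) word_length N (section g v).

Lemma nucleus_generates : generated N = [set: G].
Proof.
have [S SG _] := fin_gen_extend [::] fG.
exact: (contracting_generates sX SG).
Qed.

(** Allows additive constants to be absorbed into the linear bound. *)
Lemma section_length_gt0 n g : rist_level X n g -> g != 1 ->
  (0 < section_length n g)%N.
Proof.
move=> gn g1; rewrite lt0n; apply: contra g1 => /eqP s0; apply/eqP/fX.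
have s1 (v : seq X) : size v = n -> section g v = 1.
  move=> /eqP vn; apply/eqP; apply: contraT => gv; move/eqP: s0.
  rewrite sum_nat_eq0 => /forallP/(_ (Tuple vn)) /=.
  by rewrite eqn0Ngt (word_length_gt0 nucleus_generates gv).
have long (w : seq X) : (n <= size w)%N -> word_act g w = w.
  move=> nw; rewrite -(cat_take_drop n w) word_act_cat.
  have tn : size (take n w) = n by rewrite size_takel.
  by rewrite (rist_level_fix gn tn) s1 // word_act1.
(* A possibly short word is lengthened by [n] letters and then recovered as a prefix. *)
move=> [//|x w]; have := long ((x :: w) ++ nseq n x).
rewrite size_cat size_nseq leq_addl word_act_cat => /(_ isT)/eqP.
by rewrite eqseq_cat ?size_word_act // => /andP[/eqP].
Qed.

Definition bounded_variation {Y : choiceType} (act : G -> Y -> Y) (a :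
  pred Y) :=
  exists c n0, forall n, (n0 <= n)%N ->
    forall g, commutator_subgroup (rist_level X n) g ->
    exists2 s : seq Y, (size s <= c * section_length n g)%N
      & forall y, a y != a (act g y) -> y \in s.

Lemma commutator_rist_level n g :
  commutator_subgroup (rist_level X n) g -> rist_level X n g.
Proof. exact: (commutator_sub (generated_subgroup _)). Qed.

Section Actions.
Context {Y : choiceType} (act : G -> Y -> Y).
Hypothesis actP : is_action act.
Implicit Types (a : pred Y) (y : Y).

Lemma bounded_variationN a :
  bounded_variation act (predC a) -> bounded_variation act a.
Proof.
move=> [c [n0 H]]; exists c, n0 => n nn0 g Hg; have [s sK sP] := H n nn0 g Hg.
by exists s => // y ne; apply: sP; move: ne => /=; case: (a y); case: (a _).
Qed.

(** A point where the predicates differ affects only itself and its preimage under [g], whence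
    [2 * size e]; for [g != 1] positivity of the length turns this into a multiplicative
    constant. *)
Lemma bounded_variation_diff a a' : finite_set [set y | a y != a' y] ->
  bounded_variation act a' -> bounded_variation act a.
Proof.
move=> /finite_seqP[e eP] [c [n0 H]]; exists (c + 2 * size e)%N, n0.
move=> n nn0 g Hg; have [->|g1] := eqVneq g 1.
  by exists [::] => // y; rewrite (act1 actP) eqxx.
have [s sK sP] := H n nn0 g Hg.
exists (s ++ (e ++ [seq act g^-1 y | y <- e])).
  rewrite mulnDl !size_cat size_map leq_add // addnn -mul2n leq_pmulr //.
  exact: section_length_gt0 (commutator_rist_level Hg) g1.
have eE y : a y != a' y -> y \in e.
  by move=> ne; have : [set` e] y by rewrite -eP.
move=> y ne; rewrite !mem_cat.
have [e1|/eE->] := eqVneq (a y) (a' y); last by rewrite orbT.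
have [e2|/eE gye] := eqVneq (a (act g y)) (a' (act g y)).
  by rewrite sP // -e1 -e2.
by rewrite -{3}(actK actP g y) (map_f _ gye) !orbT.
Qed.

Lemma bounded_variation0 : bounded_variation act pred0.
Proof. by exists 0, 0 => n _ g _; exists [::]. Qed.

Lemma bounded_variationU a a' : bounded_variation act a ->
  bounded_variation act a' -> bounded_variation act (predU a a').
Proof.
move=> [c [n0 H]] [c' [n0' H']]; exists (c + c')%N, (maxn n0 n0').
move=> n; rewrite geq_max => /andP[nn0 nn0'] g Hg.
have [s sK sP] := H n nn0 g Hg; have [s' sK' sP'] := H' n nn0' g Hg.
exists (s ++ s'); first by rewrite size_cat mulnDl leq_add.
move=> y /= ne; rewrite mem_cat;
  have [e1|/sP->//] := eqVneq (a y) (a (act g y)).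
by rewrite sP' ?orbT //; apply: contra ne => /eqP ->; rewrite e1.
Qed.

Lemma bounded_variation_transitive a : (forall y z, exists g, act g y = z) ->
  almost_invariant act a -> bounded_variation act a.
Proof.
move=> tr aA; have [fa|inf_a] := pselect (finite_set [set y | a y]).
  apply: (bounded_variation_diff _ bounded_variation0).
  by apply: sub_finite_set fa => y /=; case: (a y).
have [fna|inf_na] := pselect (finite_set [set y | ~~ a y]).
  apply/bounded_variationN/(bounded_variation_diff _ bounded_variation0).
  by apply: sub_finite_set fna => y /=; case: (a y).
have [Nfin _] := cN; have /finite_seqP[Ns NE] := Nfin.
have [S SG NS] := fin_gen_extend Ns fG.
have [[v [y [av infQ]]]|finQ] := pselect (exists v y, @active _ _ X _ act v y /\
    ~ finite_set (act_orbit act (@point_kernel _ _ X v) y)).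
  have [m mP] := infinite_point_kernel_orbit actP SG fX bX tr aA inf_a inf_na
    av infQ.
  by exists 0, m => n /mP H g /H Hg; exists [::] => // z; rewrite Hg eqxx.
have {}finQ (v : seq X) y : active act v y ->
    finite_set (act_orbit act (point_kernel v) y).
  by move=> av; apply: contrapT => inf; apply: finQ; exists v, y.
have infY : ~ finite_set [set: Y].
  by move=> fY; apply: inf_a; apply: sub_finite_set fY.
have [c cP] := section_cover actP SG fX bX tr finQ infY aA inf_a inf_na sX cX.
apply: (bounded_variation_diff (saturation_finite actP SG fX bX tr finQ infY
  aA inf_a inf_na)).
exists c, 0 => n _ g /commutator_rist_level gn.
pose D (v : n.-tuple X) y := active act (tval v) y /\
  saturation X act a y != saturation X act a (act g y).
have [v _|s sK sP] := @cover_union _ Y (enum {: n.-tuple X}) D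
    (fun v => c * word_length N (section g v))%N.
  have [ts [<- tsN gE]] := word_lengthP (section g v) nucleus_generates.
  have tsS : {subset ts <= S}.
    have NS' h : N h -> h \in S by rewrite NE; apply: NS.
    have [_ SV _] := SG; move=> h /tsN[/NS'//|/NS'/SV].
    by rewrite invgK.
  have [s sK sP] := cP v g ts tsS (rist_level_fix gn (size_tuple v)) gE.
  by exists s => // y [av ne]; apply: sP.
exists s; first by rewrite /section_length big_distrr /= -big_enum.
(* Every point has an active vertex on level [n], so the covers found vertex by vertex catch all
   changes. *)
move=> y ne; have [v vn av] := active_exists actP fX bX tr n y infY.
by move/eqP: vn => vn; apply: (sP (Tuple vn)); rewrite ?mem_enum.
Qed.

End Actions.

Section Orbits.
Context {Y : choiceType} (act : G -> Y -> Y).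
Hypothesis actP : is_action act.
Implicit Types (a : pred Y) (y : Y).

Definition in_orbit y0 : pred Y := fun y => `[< exists g, act g y0 = y >].

Lemma in_orbit_act y0 g y : in_orbit y0 (act g y) = in_orbit y0 y.
Proof.
apply/asboolP/asboolP => -[h hE]; last by exists (g * h);
  rewrite (actM actP) hE.
by exists (g^-1 * h); rewrite (actM actP) hE (actK actP).
Qed.

Lemma bounded_variation_orbit a y0 : almost_invariant act a ->
  bounded_variation act (predI a (in_orbit y0)).
Proof.
move=> aA; pose Z := {y : Y | in_orbit y0 y}.
have Zact g (z : Z) : in_orbit y0 (act g (val z)) by rewrite in_orbit_act
  (valP z).
pose actZ g (z : Z) : Z := Sub (act g (val z)) (Zact g z).
have actZP : is_action actZ.
  split=> [z|g h z]; apply: val_inj; rewrite /= ?SubK; first exact: act1.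
  exact: actM.
have trZ (y z : Z) : exists g, actZ g y = z.
  have /asboolP[g gy] := valP y; have /asboolP[h hz] := valP z.
  exists (h * g^-1); apply: val_inj; rewrite /= ?SubK.
  by rewrite -gy -hz (actM actP) (actK actP).
have aZ : almost_invariant actZ (fun z : Z => a (val z)).
  move=> g; have /finite_seqP[s sE] := aA g.
  apply: (@sub_finite_set _ _ [set` (pmap insub s : seq Z)]);
    last exact: finite_seq.
  move=> z /= ne; rewrite mem_pmap_sub.
  by have : [set` s] (val z) by rewrite -sE.
have [c [n0 H]] := bounded_variation_transitive actZP trZ aZ.
exists c, n0 => n nn0 g Hg; have [s sK sP] := H n nn0 g Hg.
exists [seq val z | z <- s]; first by rewrite size_map.
move=> y /=; rewrite in_orbit_act; have [oy|] := boolP (in_orbit y0 y);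
  last first.
  by rewrite !andbF eqxx.
rewrite !andbT => ne; apply/mapP; exists (Sub y oy : Z); last by rewrite SubK.
exact: sP.
Qed.

(** On an orbit missing the finite boundary [a] is constant, so finitely many orbits contribute. *)
Lemma almost_invariant_bounded a :
  almost_invariant act a -> bounded_variation act a.
Proof.
move=> aA; have [S SG _] := fin_gen_extend [::] fG.
have /finite_seqP[F FE] := finite_boundary S aA.
pose inF (l : seq Y) y := has (fun y0 => in_orbit y0 y) l.
have [c [n0 H]] : bounded_variation act (predI a (inF F)).
  elim: (F) => [|y0 l [c [n0 H]]].
    by exists 0, 0 => n _ g _; exists [::] => // y /=; rewrite !andbF.
  have [c' [n0' H']] := bounded_variationU (bounded_variation_orbit y0 aA)
    (ex_intro _ c (ex_intro _ n0 H)).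
  exists c', n0' => n nn0 g Hg; have [s sK sP] := H' n nn0 g Hg.
  have E z : predI a (inF (y0 :: l)) z =
      predU (predI a (in_orbit y0)) (predI a (inF l)) z.
    exact: (andb_orr (a z) (in_orbit y0 z)).
  by exists s => // y; rewrite !E; apply: sP.
exists c, n0 => n nn0 g Hg; have [s sK sP] := H n nn0 g Hg.
exists s => // y ne; apply: sP => /=.
have inFg : inF F (act g y) = inF F y.
  by apply: eq_has => y0; apply: in_orbit_act.
have [_ _ SP] := SG; have [w wS gE] := SP g I; rewrite inFg.
have [i] : exists i, boundary act S a (act (\prod_(h <- drop i w) h) y).
  by apply: word_boundary => //; rewrite -gE.
rewrite FE /= => wF; suff -> : inF F y by rewrite !andbT.
apply/hasP; eexists; first exact: wF.
by apply/asboolP; exists (\prod_(h <- drop i w) h)^-1; rewrite (actK actP).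
Qed.

End Orbits.

Lemma cardinal_definite_bound nu : cardinal_definite nu ->
  exists c n0, forall n, (n0 <= n)%N ->
    forall g, commutator_subgroup (rist_level X n) g ->
    (nu g <= c * section_length n g)%N.
Proof.
move=> [Y [act [A [actP comA nuE]]]]; pose a y := `[< A y >].
have aE g y : a y != a (act g y) -> ((act g @` A) `+` A) (act g y).
  have iff : (act g @` A) (act g y) <-> A y.
    by split=> [[z Az /(act_inj actP) <-]|Ay]; [|exists y].
  have [Ay|Ay] := pselect (A y); have [Ag|Ag] := pselect (A (act g y)).
  - by rewrite /a !asboolT.
  - by left; split=> //; apply/iff.
  - by right; split=> // /iff.
  - by rewrite /a !asboolF.
have aA : almost_invariant act a.
  move=> g; apply: (@sub_finite_set _ _ [set y | ((act g @` A) `+` A) (act g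
    y)]).
    by move=> y; apply: aE.
  exact/(@finite_translate _ _ _ actP g).
have [c [n0 H]] := almost_invariant_bounded actP aA.
exists c, n0 => n nn0 g Hg; have [s sK sP] := H n nn0 g Hg.
(* The symmetric difference is the image under [g] of the points where [a] changes. *)
apply: leq_trans sK; rewrite nuE -(size_map (act g) s).
apply: uniq_leq_size (fset_uniq _) _ => y.
rewrite in_fset_set ?inE; last exact: comA.
have yE : y = act g (act g^-1 y) by rewrite (actVK actP).
move=> Dy; rewrite yE; apply: map_f; apply: sP; rewrite (actVK actP).
have iff : (act g @` A) y <-> A (act g^-1 y).
  by split=> [[z Az <-]|Ay]; [rewrite (actK actP)|exists (act g^-1 y)].
case: Dy => -[H1 H2].
  have -> : a (act g^-1 y) by apply/asboolP/iff.
  by apply/asboolPn.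
have -> : a y by apply/asboolP.
by rewrite eqb_id; apply/asboolPn => /iff.
Qed.

End Bound.

(** * Regular branch groups and Property PW *)

Section RegularBranch.
Local Open Scope classical_set_scope.
Local Open Scope group_scope.
Context {G : groupType} {B : biset G}.
Implicit Types (X Z : basis B) (K : set G) (g h k f : G).

Lemma decompP X (b : B) : b = ract (val (decomp X b).1) (decomp X b).2.
Proof. exact: proj2_sig (cid (decomp_subproof X b)). Qed.

(* The condition [K^Z <= K] read in the biset. *)
Definition diagonal_closed Z K := forall c : Z -> G, (forall z, K (c z)) ->
  exists2 g, K g & forall z, lact g (val z) = ract (val z) (c z).

(** If [x] is [z] translated by [h], the section at [x] is the conjugate by [h] of the one at [z];
    it again acts trivially over [Z], and induction applies. *)
Lemma faithful_basis X Z : faithful X -> faithful Z.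
Proof.
move=> fX g gZ; apply: fX => w.
elim: w g gZ => //= x w IH g gZ.
have xE := decompP Z (val x); set z := (decomp Z _).1 in xE.
set h := (decomp Z _).2 in xE.
have gz : letter_act g z = z by have [] := gZ [:: z].
have [gx gs] : letter_act g x = x /\
    letter_section g x = h^-1 * letter_section g z * h.
  apply: letter_actP; rewrite xE -lractA letter_actE gz -!ractM.
  by rewrite !mulgA mulgV mul1g.
rewrite gx gs IH // => u; rewrite !word_actM.
have -> : word_act (letter_section g z) (word_act h u) = word_act h u.
  by have := gZ (z :: word_act h u); rewrite /= gz => -[].
by rewrite word_actK.
Qed.

Lemma regular_branch_diagonal Z K : faithful Z -> regular_branch_over Z K ->
  diagonal_closed Z K.
Proof.
move=> fZ [[K1 KM KV] _ KR] c Kc.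
pose a (c : Z -> G) (w : seq Z) :=
  if w is z :: w' then z :: word_act (c z) w' else [::].
have aK d d' : (forall z, d' z * d z = 1) -> cancel (a d) (a d').
  by move=> dd [|z w] //=; rewrite -word_actM dd word_act1.
have [|k Kk kE] := KR (a c).
  split.
  - split=> [|[|z w] //=|[|z v] [|z' w] //=]; last 2 first.
    + by rewrite size_word_act.
    + by move=> /andP[/eqP-> vw]; rewrite eqxx prefix_word_act.
    by exists (a (fun z => (c z)^-1)); apply: aK => z; rewrite ?mulVg ?mulgV.
  - by [].
  - by move=> z; exists (c z).
exists k => // z; rewrite letter_actE.
have kz (w : seq Z) : letter_act k z = z /\
  word_act (letter_section k z) w = word_act (c z) w.
  by have [] := kE (z :: w).
have [-> _] := kz [::]; congr ract.
by apply: (word_act_ext fZ) => w; case: (kz w).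
Qed.

Lemma lact_basis_ext Z g h : faithful Z ->
  (forall z : Z, lact g (val z) = lact h (val z)) -> g = h.
Proof.
move=> fZ gh; apply: (word_act_ext fZ) => -[//|z w] /=.
have := letter_actE g z; rewrite gh => /letter_actP[-> ->].
by [].
Qed.

(** Conjugating a diagonal element by [f] permutes and conjugates its entries, so the conjugate is
    again realized in [K]. *)
Lemma diagonal_closed_core Z K : faithful Z -> diagonal_closed Z K ->
  diagonal_closed Z [set k | forall g, K (g^-1 * k * g)].
Proof.
move=> fZ dK c Kc; have [|g Kg gc] := dK c.
  by move=> z; have := Kc z 1; rewrite invg1 mul1g mulg1.
exists g => // f.
have [|g' Kg' gc'] := dK (fun z => (letter_section f z)^-1 *
    c (letter_act f z) * letter_section f z).
  by move=> z; apply: Kc.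
suff gf : g * f = f * g' by rewrite -mulgA gf mulKg.
apply: (lact_basis_ext fZ) => z.
rewrite !lactM gc' -lractA letter_actE -lractA gc -!ractM.
by rewrite !mulgA mulgV mul1g.
Qed.

(** Rewriting the letters of one basis over the other conjugates the entries of the family, which
    normality of [K] absorbs. *)
Lemma diagonal_closed_basis X Z K : (forall g k, K k -> K (g^-1 * k * g)) ->
  diagonal_closed Z K -> diagonal_closed X K.
Proof.
move=> KJ dK c Kc.
have [|g Kg gc] := dK (fun z => (decomp X (val z)).2^-1 *
    c (decomp X (val z)).1 * (decomp X (val z)).2).
  by move=> z; apply: KJ.
exists g => // x; have xE := decompP Z (val x).
move: (decomp Z (val x)) xE => [z h] /= xE.
have zE := decompP X (val z); move: (decomp X (val z)) zE (gc z) =>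
  [x' h'] /= zE gz.
have [xx' h'E] : x = x' /\ 1 = h' * h.
  by apply: (@ract_basis_inj _ _ X); rewrite ractM -zE -xE ract1.
rewrite {1}xE -lractA gz zE -!ractM xx'; congr ract.
by rewrite !mulgA mulgV mul1g -mulgA -h'E mulg1.
Qed.

Section Lifts.
Variables (X : basis B) (K : set G).
Hypotheses (fX : faithful X) (KG : is_subgroup K) (dK : diagonal_closed X K).

Lemma rist_lift (v : seq X) k : K k ->
  exists g, [/\ K g, rist v g & section g v = k].
Proof.
have [K1 _ _] := KG; move=> Kk; elim: v => [|x v [g [Kg Lg gs]]].
  by exists k; split=> // w; rewrite prefix0s.
pose c z := if z == x then g else 1.
have [|h Kh hc] := dK (c := c); first by move=> z; rewrite /c; case: eqP.
have hE z : letter_act h z = z /\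
  letter_section h z = c z by apply: letter_actP.
exists h; split=> //=; last by have [_ ->] := hE x; rewrite /c eqxx.
move=> [//|z w] /=; have [-> ->] := hE z; rewrite /c [x == z]eq_sym.
by case: eqP => [->|_] /=; [move=> /Lg->|rewrite word_act1].
Qed.

Lemma noncommuting_lift : (exists2 k, K k & k != 1) ->
  exists k k', [/\ K k, K k' & [~ k, k'] != 1].
Proof.
move=> [k Kk k1]; have [v kv] : exists v : seq X, word_act k v != v.
  apply: contrapT => no; move/eqP: k1; apply; apply: fX => w.
  by apply: contrapT => /eqP kw; apply: no; exists w.
have [p [Kp Lp ps]] := rist_lift v Kk; exists k, p; split=> //.
apply: contra k1 => /commgP kp; rewrite -ps.
have -> : p = 1; last by rewrite section1.
apply: (rist_point_kernelI fX Lp).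
have -> : p = k * p * k^-1 by rewrite kp mulgK.
apply: (rist_point_kernel fX _ _ (ristJ Lp)); first by rewrite size_word_act.
by rewrite eq_sym.
Qed.

(** The commutator is supported below the single vertex [v], so its total length does not depend on
    [n]. *)
Lemma commutator_lift n (v : n.-tuple X) k k' N : K k -> K k' ->
  exists c, [/\ commutator_subgroup (rist_level X n) c, section c v = [~ k, k']
    & section_length X N n c = word_length N [~ k, k']].
Proof.
move=> Kk Kk'; have [p [_ Lp ps]] := rist_lift v Kk.
have [q [_ Lq qs]] := rist_lift v Kk'.
have vn : size v = n by rewrite size_tuple.
have [_ LM LV] := rist_subgroup (val v).
have Lc : rist (val v) [~ p, q].
  by apply: (LM _ _ (LV _ Lp)); apply: (LM _ _ (LV _ Lq)); apply: LM.
have sV g : rist (val v) g -> section g^-1 v = (section g v)^-1.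
  by move=> Lg; rewrite sectionV (rist_fix (LV _ Lg)).
have sM g h : rist (val v) h -> section (g * h) v = section g v * section h v.
  by move=> Lh; rewrite sectionM (rist_fix Lh).
have sc : section [~ p, q] v = [~ k, k'].
  have Lpq := LM _ _ Lp Lq; have LVpq := LM _ _ (LV _ Lq) Lpq.
  by rewrite /commg /conjg (sM p^-1) // (sM q^-1) // sM // !sV // ps qs.
exists [~ p, q]; split=> //.
  apply: sub_generated; exists p, q; split=> //; apply: sub_generated.
    by exists (val v).
  by exists (val v).
rewrite /section_length (bigD1 v) //= sc big1 ?addn0 // => u uv.
by rewrite (rist_section1 fX Lc) ?size_tuple // word_length1.
Qed.

End Lifts.

(** With [n] elements one word has at most [n] images, fewer than the words of length [n]. *)
Lemma infinite_transitive X : (1 < #|{: X}|)%N ->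
  (forall v w : seq X, size v = size w -> exists g, word_act g v = w) ->
  ~ finite_set [set: G].
Proof.
move=> X1 tX /finite_seqP[s sE].
have [x _] : exists x : X, x \in {: X} by apply/card_gt0P; apply: ltnW.
pose n := size s; pose ws : seq (seq X) :=
  [seq tval t | t <- enum {: n.-tuple X}].
have : (size ws <= size [seq word_act g (nseq n x) | g <- s])%N.
  apply: uniq_leq_size.
    by rewrite map_inj_uniq ?enum_uniq //; apply: val_inj.
  move=> _ /mapP[t _ ->]; have [|g gt] := tX (nseq n x) t.
    by rewrite size_nseq size_tuple.
  rewrite -gt; apply/mapP; exists g => //.
  by have : [set` s] g by rewrite -sE.
have -> : size ws = (#|{: X}| ^ n)%N by rewrite size_map -card_tuple cardE.
by rewrite size_map leqNgt ltn_expl.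
Qed.

Lemma rist_level_escape X (s : seq G) : faithful X -> exists m, {in s,
  forall g n,
  (m <= n)%N -> g != 1 -> ~ rist_level X n g}.
Proof.
move=> fX; apply: uniform_bound => g _.
have [->|g1] := eqVneq g 1; first by exists 0 => n _ /eqP.
have [v gv] : exists v : seq X, word_act g v != v.
  apply: contrapT => no; move/eqP: g1; apply; apply: fX => w.
  by apply: contrapT => /eqP kw; apply: no; exists w.
exists (size v) => n vn _ gn; move/eqP: gv; apply.
exact: (rist_level_fix (rist_level_le vn gn)).
Qed.

Lemma regular_branch_not_PW X N : finitely_generated G -> faithful X ->
  contracting X -> self_replicating X -> branch X -> contracting_set X N ->
  (1 < #|{: X}|)%N -> regular_branch B -> ~ property_PW G.
Proof.
move=> fG fX cX sX bX cN X1 [Z [K0 ZK]] [nu nuC nuP].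
have fZ := faithful_basis (Z := Z) fX; have [K0G K0f _] := ZK.
(* The branching subgroup may live over another basis [Z]; its normal core can be transferred to
   [X]. *)
pose K := [set k | forall g, K0 (g^-1 * k * g)].
have sK : fin_sep [set: G] K.
  exact: finite_index_core (finite_index_sep K0G K0f).
have KG : is_subgroup K.
  have [K1 KM KV] := K0G; split=> [g|k k' Hk Hk' g|k Hk g].
  - by rewrite mulg1 mulVg.
  - have -> : g^-1 * (k * k') * g = (g^-1 * k * g) * (g^-1 * k' * g).
      by rewrite !mulgA mulgK.
    exact: KM.
  - by have := KV _ (Hk g); rewrite !invgM invgK mulgA.
have KJ g k : K k -> K (g^-1 * k * g).
  by move=> Kk h; have := Kk (g * h); rewrite invgM !mulgA.
have dK : diagonal_closed X K.
  apply: (diagonal_closed_basis KJ); apply: (diagonal_closed_core fZ).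
  exact: regular_branch_diagonal.
have infG := infinite_transitive X1 bX.1.
have [k [_ Kk k1]] := fin_sep_infinite sK infG (And3 I (fun _ _ _ _ =>
  I) (fun _ _ => I)).
have [p [q [Kp Kq pq]]] := noncommuting_lift fX KG dK (ex_intro2 _ _ k Kk k1).
have [c [n0 bound]] := cardinal_definite_bound fG fX cX sX bX cN nuC.
(* This bound does not involve the level, so the lifts on all levels from [n0] on lie in the finite
   list [s]; deep enough, [RiSt(n)] contains no nontrivial entry of [s]. *)
have /finite_seqP[s sE] := nuP (c * word_length N [~ p, q])%N.
have [m mP] := rist_level_escape s fX; pose n := maxn m n0.
have [x _] : exists x : X, x \in {: X} by apply/card_gt0P; apply: ltnW.
have [g [gc gs gl]] := commutator_lift fX KG dK [tuple of nseq n x] N Kp Kq.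
have gS : g \in s.
  suff : [set` s] g by [].
  by rewrite -sE /= -gl; apply: bound gc; apply: leq_maxr.
apply: (mP g gS n (leq_maxl _ _)); last exact: commutator_rist_level.
by apply: contra pq => /eqP g1; rewrite -gs g1 section1.
Qed.

End RegularBranch.

Local Open Scope ring_scope.

Theorem corollary5p19 (R : realType) (G : groupType) (B : biset G)
    (X : basis B) (N : set G) :
  finitely_generated G -> faithful X -> contracting X ->
  self_replicating X -> branch X -> is_nucleus X N ->
  (forall nu : G -> nat, cardinal_definite nu ->
    exists (C : R) (n0 : nat), [/\ 0 < C, (1 <= n0)%N &
      forall n : nat, (n0 <= n)%N ->
      forall g : G, commutator_subgroup (rist_level X n) g ->
        (nu g)%:R <=
        C * \sum_(v : n.-tuple X) (word_length N (section g v))%:R])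
  /\ ((1 < #|{: X}|)%N -> regular_branch B -> ~ property_PW G).
Proof.
move=> fG fX cX sX bX [cN _]; split; last exact: regular_branch_not_PW cN.
move=> nu nuC; have [c [n0 H]] := cardinal_definite_bound fG fX cX sX bX cN nuC.
(* The successors secure positivity of the constant and a threshold of at least 1. *)
exists c.+1%:R, n0.+1; split; rewrite ?Num.Theory.ltr0Sn // => n n0n g Hg.
rewrite -GRing.natr_sum -GRing.natrM Num.Theory.ler_nat; apply: (leq_trans (H n (ltnW n0n) g Hg)).
by rewrite leq_mul2r leqnSn orbT.
Qed.
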